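(* Let $K\subset\mathbb{R}^2$ be any compact set and let $u\in C^2_c(\mathbb{R}^2;\mathbb{R}^2)$ with $\operatorname{div}u=0$, $u=0$ and $\nabla u=0$ on $K$. Then there exists a sequence $\{u_k\}_k\subset C^\infty_c(\mathbb{R}^2;\mathbb{R}^2)$ with $\operatorname{div}u_k=0$ and $\operatorname{supp}u_k\subset\mathbb{R}^2\setminus K$, such that $u_k\to u$ in $C^1$. *)

(* Defs.v *)
(* Points of R^2 are pairs (x,y) of curried args;
   a scalar field R^2 -> R is a function R -> R -> R, and a vector field
   R^2 -> R^2 is a pair of components (u1, u2). *)
From Stdlib Require Import Reals List.
From Coquelicot Require Import Coquelicot.
Open Scope R_scope.

(* partial derivatives (Coquelicot's total Derive; existence is asserted
   separately in the C^k definitions) *)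
Definition dx (f : R -> R -> R) : R -> R -> R :=
  fun x y => Derive (fun t => f t y) x.
Definition dy (f : R -> R -> R) : R -> R -> R :=
  fun x y => Derive (fun t => f x t) y.

Definition cont2 (f : R -> R -> R) : Prop :=
  forall x y eps, 0 < eps -> exists d, 0 < d /\
    forall x' y', Rabs (x' - x) < d -> Rabs (y' - y) < d ->
      Rabs (f x' y' - f x y) < eps.

Fixpoint Ck (k : nat) (f : R -> R -> R) : Prop :=
  cont2 f /\
  match k with
  | O => True
  | S k' => (forall x y, ex_derive (fun t => f t y) x /\
                         ex_derive (fun t => f x t) y)
            /\ Ck k' (dx f) /\ Ck k' (dy f)
  end.

Definition Cinf (f : R -> R -> R) : Prop := forall k, Ck k f.

Definition compact_supp (f : R -> R -> R) : Prop :=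
  exists M, forall x y, M < Rabs x \/ M < Rabs y -> f x y = 0.

(* supp f = closure {f <> 0} does not meet K: every point of K has a
   neighbourhood on which f vanishes *)
Definition supp_disjoint (f : R -> R -> R) (K : R -> R -> Prop) : Prop :=
  forall x y, K x y -> exists d, 0 < d /\
    forall x' y', Rabs (x' - x) < d -> Rabs (y' - y) < d -> f x' y' = 0.

Definition open2 (U : R -> R -> Prop) : Prop :=
  forall x y, U x y -> exists d, 0 < d /\
    forall x' y', Rabs (x' - x) < d -> Rabs (y' - y) < d -> U x' y'.

Definition compact2 (K : R -> R -> Prop) : Prop :=
  forall (I : Type) (U : I -> R -> R -> Prop),
    (forall i, open2 (U i)) ->
    (forall x y, K x y -> exists i, U i x y) ->
    exists l : list I, forall x y, K x y -> exists i, In i l /\ U i x y.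

Definition div2 (u1 u2 : R -> R -> R) : R -> R -> R :=
  fun x y => dx u1 x y + dy u2 x y.

Definition C1_conv (fk : nat -> R -> R -> R) (f : R -> R -> R) : Prop :=
  forall eps, 0 < eps -> exists N, forall n, (N <= n)%nat -> forall x y,
    Rabs (fk n x y - f x y) <= eps /\
    Rabs (dx (fk n) x y - dx f x y) <= eps /\
    Rabs (dy (fk n) x y - dy f x y) <= eps.

(* Main.v *)
Require Import Defs.
From Stdlib Require Import Reals List Lra Lia Classical ClassicalEpsilon FunctionalExtensionality.
From Coquelicot Require Import Coquelicot.
Open Scope R_scope.

(** Write [u] as the rotated gradient of a stream function [psi], whose first and second
    derivatives vanish on [K].  It suffices to find [V], small in C^2, that differs from [psi] by
    a constant near each point of [K]: then [u] minus the rotated gradient of [V] vanishes near [K]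
    and can be mollified.  By an elementary Morse-Sard argument [psi(K)] is null, so there is [h]
    of arbitrarily small amplitude with [0 <= h' <= 1] and [h' = 1] near [psi(K)].  The
    composition [h(psi)] would do except for the term [h''(psi) |grad psi|^2], as [h''] is huge.
    Averaging [h] around [psi] over a window of half-width [s = A |u|^2] replaces [h''] by
    [O(1/s)], so that this term becomes [O(1/A)], while [s] itself has small second derivatives
    near [K].  Finally [V] is this average times a fixed cutoff function; the cross terms are small
    by interpolation, because the amplitude of [h] is chosen last. *)

(** * Continuity *)

(** The obstacle is that [psi] need not be constant on [K]. If it vanished there, a cutoff in the
    plane at distance delta from [K] would do: [psi = o(delta^2)] would balance the second
    derivatives of the cutoff, of order [1 / delta^2]. But [K] may have infinitely many components
    carrying different values of [psi], with no room to pass from one constant to another at a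
    controlled scale. Hence the truncation is performed on the values of [psi], where only a null
    set has to be preserved. The price is that a level of [psi] close to a critical value also
    passes through points off [K], where the gradient is nonzero while [h'] drops from 1 to 0 over a
    tiny interval. A window proportional to [|grad psi|^2] adapts the steepness of the drop to the
    gradient at each point. It also closes up on [K], so that near [K] it stays inside the region
    where [h' = 1]. The C^2 regularity of [u] enters through the width of the window, which must
    itself be twice continuously differentiable. *)

Section RealValuedContinuity.
Context {U : UniformSpace}.
Implicit Types (f g : U -> R) (p : U).

Lemma cts_plus f g p :
  continuous f p -> continuous g p -> continuous (fun q => f q + g q) p.
Proof. exact (continuous_plus f g p). Qed.

Lemma cts_minus f g p :
  continuous f p -> continuous g p -> continuous (fun q => f q - g q) p.
Proof. exact (continuous_minus f g p). Qed.

Lemma cts_opp f p : continuous f p -> continuous (fun q => - f q) p.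
Proof. exact (continuous_opp f p). Qed.

Lemma cts_mult f g p :
  continuous f p -> continuous g p -> continuous (fun q => f q * g q) p.
Proof. exact (continuous_mult f g p). Qed.

Lemma cts_const (c : R) p : continuous (fun _ : U => c) p.
Proof. exact (continuous_const c p). Qed.

Lemma cts_pow f n p : continuous f p -> continuous (fun q => f q ^ n) p.
Proof.
intros Hf; induction n as [|n IH]; simpl.
- apply cts_const.
- apply cts_mult; assumption.
Qed.

Lemma cts_comp (phi : R -> R) f p :
  continuous f p -> continuous phi (f p) -> continuous (fun q => phi (f q)) p.
Proof. exact (continuous_comp f phi p). Qed.

End RealValuedContinuity.

Lemma cont2_pt f x y : cont2 f -> continuity_2d_pt f x y.
Proof.
intros H eps; destruct (H x y eps (cond_pos eps)) as [d [Hd H']].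
exists (mkposreal d Hd); intros u v Hu Hv; apply H'; assumption.
Qed.

Lemma cont2_iff f :
  cont2 f <-> forall p : R * R, continuous (fun q => f (fst q) (snd q)) p.
Proof.
split.
- intros H [x y]; apply continuity_2d_pt_filterlim, cont2_pt, H.
- intros H x y eps He.
  destruct (proj2 (continuity_2d_pt_filterlim f x y) (H (x, y)) (mkposreal eps He))
    as [d Hd].
  exists d; split; [apply cond_pos|]; intros; apply Hd; assumption.
Qed.

Lemma cts_cont2 {U : UniformSpace} (f : R -> R -> R) (a b : U -> R) p :
  cont2 f -> continuous a p -> continuous b p ->
  continuous (fun q => f (a q) (b q)) p.
Proof.
intros Hf Ha Hb; apply continuous_comp_2; [assumption..|].
apply (proj1 (cont2_iff f) Hf).
Qed.

Lemma cont2_plus f g : cont2 f -> cont2 g -> cont2 (fun x y => f x y + g x y).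
Proof.
rewrite !cont2_iff; intros Hf Hg p; apply cts_plus; [apply Hf | apply Hg].
Qed.

Lemma cont2_mult f g : cont2 f -> cont2 g -> cont2 (fun x y => f x y * g x y).
Proof.
rewrite !cont2_iff; intros Hf Hg p; apply cts_mult; [apply Hf | apply Hg].
Qed.

Lemma cont2_const c : cont2 (fun _ _ => c).
Proof. apply cont2_iff; intros p; apply cts_const. Qed.

Definition cont3 (F : R -> R -> R -> R) : Prop :=
  forall p : R * (R * R), continuous (fun q => F (fst q) (fst (snd q)) (snd (snd q))) p.

Lemma cts_fst {U V : UniformSpace} (p : U * V) : continuous (fun q : U * V => fst q) p.
Proof. destruct p as [u v]; apply continuous_fst. Qed.

Lemma cts_snd {U V : UniformSpace} (p : U * V) : continuous (fun q : U * V => snd q) p.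
Proof. destruct p as [u v]; apply continuous_snd. Qed.

Lemma cts_fst_snd {U V W : UniformSpace} (p : U * (V * W)) :
  continuous (fun q : U * (V * W) => fst (snd q)) p.
Proof. apply continuous_comp; [apply cts_snd | apply cts_fst]. Qed.

Lemma cts_snd_snd {U V W : UniformSpace} (p : U * (V * W)) :
  continuous (fun q : U * (V * W) => snd (snd q)) p.
Proof. apply continuous_comp; apply cts_snd. Qed.

Lemma cts_cont3 {U : UniformSpace} (F : R -> R -> R -> R) (a b c : U -> R) p :
  cont3 F -> continuous a p -> continuous b p -> continuous c p ->
  continuous (fun q => F (a q) (b q) (c q)) p.
Proof.
intros HF Ha Hb Hc.
apply (continuous_comp_2 a (fun q => (b q, c q)) (fun u v => F u (fst v) (snd v)) p Ha).
- apply (continuous_comp_2 b c pair p Hb Hc).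
  apply (continuous_ext (fun x => x)); [intros []; reflexivity | apply continuous_id].
- apply HF.
Qed.

Lemma cont3_section F x y z : cont3 F -> continuous (fun t => F t x y) z.
Proof.
intros HF; apply (cts_cont3 F); [assumption | apply continuous_id | apply cts_const..].
Qed.

Lemma ex_RInt_cts (f : R -> R) a b : (forall z, continuous f z) -> ex_RInt f a b.
Proof. intros H; apply (@ex_RInt_continuous R_CompleteNormedModule); intros z _; apply H. Qed.

Lemma cont3_ex_RInt F x y a b : cont3 F -> ex_RInt (fun z => F z x y) a b.
Proof. intros HF; apply ex_RInt_cts; intros z; apply cont3_section, HF. Qed.

Lemma cont3_local F : cont3 F -> forall z x y eps, 0 < eps -> exists d : posreal,
  forall z' x' y', Rabs (z' - z) < d -> Rabs (x' - x) < d -> Rabs (y' - y) < d ->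
    Rabs (F z' x' y' - F z x y) < eps.
Proof.
intros HF z x y eps He.
destruct (proj1 (filterlim_locally _ _) (HF (z, (x, y))) (mkposreal eps He)) as [d Hd].
exists d; intros z' x' y' Hz Hx Hy.
apply (Hd (z', (x', y'))); repeat split; assumption.
Qed.

(** Compactness of the segment: joint continuity at [(t, x, y)] controls both [F z x' y'] and
    [F z x y] for [z] near [t], each with half the tolerance, and finitely many [t] suffice.
    [compactness_value_1d] delivers [t] only under a double negation. *)
Lemma tube F a b x y eps : cont3 F -> 0 < eps ->
  exists d, 0 < d /\ forall z x' y', a <= z <= b ->
    Rabs (x' - x) < d -> Rabs (y' - y) < d -> Rabs (F z x' y' - F z x y) < eps.
Proof.
intros HF He.
assert (He2 : 0 < eps / 2) by lra.
pose (dl := fun z => proj1_sig (constructive_indefinite_description _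
  (cont3_local F HF z x y (eps / 2) He2))).
assert (Hdl : forall z z' x' y', Rabs (z' - z) < dl z -> Rabs (x' - x) < dl z ->
    Rabs (y' - y) < dl z -> Rabs (F z' x' y' - F z x y) < eps / 2).
{ intros z; unfold dl; apply proj2_sig. }
destruct (compactness_value_1d a b dl) as [d Hd].
exists d; split; [apply cond_pos|]; intros z x' y' Hz Hx Hy.
destruct (NNPP _ (Hd z Hz)) as [t [_ [Ht Hdt]]].
assert (H1 : Rabs (F z x' y' - F t x y) < eps / 2) by (apply Hdl; lra).
assert (H2 : Rabs (F z x y - F t x y) < eps / 2).
{ apply Hdl; [assumption | |]; rewrite Rminus_diag, Rabs_R0; apply cond_pos. }
apply Rabs_def2 in H1; apply Rabs_def2 in H2; apply Rabs_def1; lra.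
Qed.

Lemma cont2_RInt F a b : a <= b -> cont3 F ->
  cont2 (fun x y => RInt (fun z => F z x y) a b).
Proof.
intros Hab HF x y eps He.
(* The [+ 1] keeps the denominator positive when [a = b]. *)
assert (He' : 0 < eps / (b - a + 1)) by (apply Rdiv_lt_0_compat; lra).
destruct (tube F a b x y _ HF He') as [d [Hd H]].
exists d; split; [assumption|]; intros x' y' Hx Hy.
replace (RInt (fun z => F z x' y') a b - RInt (fun z => F z x y) a b)
  with (RInt (fun z => F z x' y' - F z x y) a b)
  by (exact (RInt_minus _ _ a b (cont3_ex_RInt F x' y' a b HF) (cont3_ex_RInt F x y a b HF))).
apply Rle_lt_trans with ((b - a) * (eps / (b - a + 1))).
- apply abs_RInt_le_const; [assumption | |].
  + exact (ex_RInt_minus _ _ a b (cont3_ex_RInt F x' y' a b HF) (cont3_ex_RInt F x y a b HF)).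
  + intros t Ht; apply Rlt_le, H; assumption.
- apply Rmult_lt_reg_r with (b - a + 1); [lra|].
  replace ((b - a) * (eps / (b - a + 1)) * (b - a + 1)) with ((b - a) * eps) by (field; lra).
  nra.
Qed.

(** * Partial derivatives indexed by a direction *)

Definition sec (b : bool) (f : R -> R -> R) (x y t : R) : R :=
  if b then f t y else f x t.
Definition coord (b : bool) (x y : R) : R := if b then x else y.
Definition pd (b : bool) (f : R -> R -> R) : R -> R -> R := if b then dx f else dy f.
(** A relation rather than the total [Derive], so that existence and value travel together through
    the calculus rules. Direction [true] is x and [false] is y; each rule is then proved once, and
    iterated derivatives can be quantified over. *)
Definition is_pd (b : bool) (f : R -> R -> R) (x y l : R) : Prop :=
  is_derive (sec b f x y) (coord b x y) l.

Lemma sec_coord b f x y : sec b f x y (coord b x y) = f x y.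
Proof. destruct b; reflexivity. Qed.

Lemma is_pd_unique b f x y l : is_pd b f x y l -> pd b f x y = l.
Proof. destruct b; exact (is_derive_unique _ _ _). Qed.

Lemma is_pd_eq b f (g : R -> R -> R) : (forall x y, is_pd b f x y (g x y)) -> pd b f = g.
Proof.
intros H; extensionality x; extensionality y; apply is_pd_unique, H.
Qed.

Lemma is_pd_change b f x y l l' : is_pd b f x y l -> l = l' -> is_pd b f x y l'.
Proof. intros H <-; exact H. Qed.

Lemma is_pd_plus b f g x y l m : is_pd b f x y l -> is_pd b g x y m ->
  is_pd b (fun x y => f x y + g x y) x y (l + m).
Proof.
unfold is_pd; intros Hf Hg.
apply (is_derive_ext (fun t => sec b f x y t + sec b g x y t)); [destruct b; reflexivity|].
exact (is_derive_plus _ _ _ _ _ Hf Hg).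
Qed.

Lemma is_pd_mult b f g x y l m : is_pd b f x y l -> is_pd b g x y m ->
  is_pd b (fun x y => f x y * g x y) x y (l * g x y + f x y * m).
Proof.
unfold is_pd; intros Hf Hg.
apply (is_derive_ext (fun t => sec b f x y t * sec b g x y t)); [destruct b; reflexivity|].
rewrite <- (sec_coord b f x y), <- (sec_coord b g x y).
exact (is_derive_mult _ _ _ _ _ Hf Hg Rmult_comm).
Qed.

Lemma is_pd_const b c x y : is_pd b (fun _ _ => c) x y 0.
Proof.
unfold is_pd; apply (is_derive_ext (fun _ => c)); [destruct b; reflexivity|].
exact (is_derive_const _ _).
Qed.

Lemma is_pd_comp b (phi : R -> R) f x y l m :
  is_derive phi (f x y) m -> is_pd b f x y l ->
  is_pd b (fun x y => phi (f x y)) x y (m * l).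
Proof.
unfold is_pd; intros Hphi Hf.
apply (is_derive_ext (fun t => phi (sec b f x y t))); [destruct b; reflexivity|].
rewrite Rmult_comm; rewrite <- (sec_coord b f x y) in Hphi.
exact (is_derive_comp _ _ _ _ _ Hphi Hf).
Qed.

Lemma pd_ext_loc b f g x y d : 0 < d ->
  (forall x' y', Rabs (x' - x) < d -> Rabs (y' - y) < d -> f x' y' = g x' y') ->
  pd b f x y = pd b g x y.
Proof.
intros Hd H; destruct b; apply Derive_ext_loc; exists (mkposreal d Hd); intros t Ht;
  apply H; try exact Ht; rewrite Rminus_diag, Rabs_R0; assumption.
Qed.

Lemma Ck_cont k f : Ck k f -> cont2 f.
Proof. destruct k; simpl; tauto. Qed.

Lemma Ck_pd k f b : Ck (S k) f -> Ck k (pd b f).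
Proof. destruct b; simpl; tauto. Qed.

Lemma Ck_is_pd k f b x y : Ck (S k) f -> is_pd b f x y (pd b f x y).
Proof.
simpl; intros [_ [H _]]; destruct (H x y) as [H1 H2].
destruct b; apply Derive_correct; assumption.
Qed.

Lemma Ck_pred k f : Ck (S k) f -> Ck k f.
Proof.
revert f; induction k as [|k IH]; intros f H.
- split; [apply (Ck_cont 1), H | exact I].
- split; [apply (Ck_cont (S (S k))), H|].
  split; [simpl in H; tauto|].
  split; apply IH; [apply (Ck_pd _ _ true H) | apply (Ck_pd _ _ false H)].
Qed.

(** * Mean value estimates and the construction of C^k functions *)

Lemma mvt_bound (f g : R -> R) a b M :
  (forall t, Rmin a b <= t <= Rmax a b -> is_derive f t (g t) /\ Rabs (g t) <= M) ->
  Rabs (f b - f a) <= M * Rabs (b - a).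
Proof.
intros H.
destruct (MVT_gen f a b g) as [c [Hc ->]].
- intros x Hx; apply H; lra.
- intros x Hx; apply derivable_continuous_pt; exists (g x).
  apply is_derive_Reals, H, Hx.
- rewrite Rabs_mult; apply Rmult_le_compat_r; [apply Rabs_pos | apply H, Hc].
Qed.

Lemma Rabs_between t a b l c : Rmin a b <= t <= Rmax a b ->
  Rabs (a - c) <= l -> Rabs (b - c) <= l -> Rabs (t - c) <= l.
Proof.
intros Ht Ha Hb; apply Rabs_le_between in Ha; apply Rabs_le_between in Hb.
apply Rabs_le_between; revert Ht; unfold Rmin, Rmax; destruct (Rle_dec a b); lra.
Qed.

(** Two moves parallel to the axes, first vertical and then horizontal, stay inside the box; each
    costs at most [M * l] by the mean value theorem in one variable. *)
Lemma box_bound f (g : bool -> R -> R -> R) x y l M :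
  (forall b x' y', Rabs (x' - x) <= l -> Rabs (y' - y) <= l ->
     is_pd b f x' y' (g b x' y') /\ Rabs (g b x' y') <= M) ->
  forall x' y', Rabs (x' - x) <= l -> Rabs (y' - y) <= l ->
    Rabs (f x' y' - f x y) <= 2 * M * l.
Proof.
intros H x' y' Hx Hy.
assert (Hl : 0 <= l) by (apply Rle_trans with (2 := Hx); apply Rabs_pos).
assert (H0 : forall z, Rabs (z - z) <= l) by (intros; rewrite Rminus_diag, Rabs_R0; lra).
assert (HM : 0 <= M).
{ apply Rle_trans with (Rabs (g true x y)); [apply Rabs_pos | apply H; apply H0]. }
assert (H1 : Rabs (f x' y' - f x' y) <= M * Rabs (y' - y)).
{ apply (mvt_bound (f x') (g false x')); intros t Ht; apply (H false x' t Hx).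
  apply (Rabs_between t y y'); auto. }
assert (H2 : Rabs (f x' y - f x y) <= M * Rabs (x' - x)).
{ apply (mvt_bound (fun t => f t y) (fun t => g true t y)); intros t Ht.
  apply (H true t y); auto; apply (Rabs_between t x x'); auto. }
replace (f x' y' - f x y) with ((f x' y' - f x' y) + (f x' y - f x y)) by ring.
apply Rle_trans with (1 := Rabs_triang _ _).
pose proof (Rmult_le_compat_l M _ _ HM Hx); pose proof (Rmult_le_compat_l M _ _ HM Hy); lra.
Qed.

(** Continuous partial derivatives are locally bounded, so [box_bound] makes [f] continuous. This
    supplies the continuity clause of [Ck], and [Ck_intro] can then ask for the partial derivatives
    alone. *)
Lemma is_pd_cont2 f (g : bool -> R -> R -> R) :
  (forall b x y, is_pd b f x y (g b x y)) -> (forall b, cont2 (g b)) -> cont2 f.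
Proof.
intros Hf Hg x y eps He.
destruct (Hg true x y 1 Rlt_0_1) as [d1 [Hd1 H1]].
destruct (Hg false x y 1 Rlt_0_1) as [d2 [Hd2 H2]].
pose (M := 1 + Rabs (g true x y) + Rabs (g false x y)).
assert (HM : 0 < M).
{ unfold M; pose proof (Rabs_pos (g true x y)); pose proof (Rabs_pos (g false x y)); lra. }
assert (Hq : 0 < eps / (4 * M)) by (apply Rdiv_lt_0_compat; lra).
pose (l := Rmin (Rmin d1 d2 / 2) (eps / (4 * M))).
assert (Hl : 0 < l < d1 /\ l < d2 /\ l <= eps / (4 * M)).
{ unfold l, Rmin; repeat destruct Rle_dec; lra. }
exists l; split; [lra|]; intros x' y' Hx Hy.
apply Rle_lt_trans with (2 * M * l).
- apply (box_bound f g x y l M); [|lra..].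
  intros b u v Hu Hv; split; [apply Hf|].
  assert (Hb : Rabs (g b u v - g b x y) < 1).
  { destruct b; [apply H1 | apply H2]; lra. }
  replace (g b u v) with ((g b u v - g b x y) + g b x y) by ring.
  apply Rle_trans with (1 := Rabs_triang _ _); unfold M.
  pose proof (Rabs_pos (g true x y)); pose proof (Rabs_pos (g false x y)); destruct b; lra.
- apply Rle_lt_trans with (2 * M * (eps / (4 * M))).
  + apply Rmult_le_compat_l; lra.
  + replace (2 * M * (eps / (4 * M))) with (eps / 2) by (field; lra); lra.
Qed.

Lemma Ck_intro k f (g : bool -> R -> R -> R) :
  (forall b x y, is_pd b f x y (g b x y)) -> (forall b, Ck k (g b)) -> Ck (S k) f.
Proof.
intros Hf Hg; split; [|split; [|split]].
- apply (is_pd_cont2 f g Hf); intros b; apply (Ck_cont k), Hg.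
- intros x y; split; eexists; [apply (Hf true) | apply (Hf false)].
- change (Ck k (pd true f)); rewrite (is_pd_eq true f _ (Hf true)); apply Hg.
- change (Ck k (pd false f)); rewrite (is_pd_eq false f _ (Hf false)); apply Hg.
Qed.

Lemma Ck_plus k f g : Ck k f -> Ck k g -> Ck k (fun x y => f x y + g x y).
Proof.
revert f g; induction k as [|k IH]; intros f g Hf Hg.
- split; [apply cont2_plus; [apply Hf | apply Hg] | exact I].
- apply (Ck_intro k _ (fun b x y => pd b f x y + pd b g x y)); intros b.
  + intros x y; apply is_pd_plus; apply (Ck_is_pd k); assumption.
  + apply IH; apply Ck_pd; assumption.
Qed.

Lemma Ck_mult k f g : Ck k f -> Ck k g -> Ck k (fun x y => f x y * g x y).
Proof.
revert f g; induction k as [|k IH]; intros f g Hf Hg.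
- split; [apply cont2_mult; [apply Hf | apply Hg] | exact I].
- apply (Ck_intro k _ (fun b x y => pd b f x y * g x y + f x y * pd b g x y)); intros b.
  + intros x y; apply is_pd_mult; apply (Ck_is_pd k); assumption.
  + apply Ck_plus; apply IH; try (apply Ck_pd; assumption); apply Ck_pred; assumption.
Qed.

Lemma Ck_const k c : Ck k (fun _ _ => c).
Proof.
revert c; induction k as [|k IH]; intros c.
- split; [apply cont2_const | exact I].
- apply (Ck_intro k _ (fun _ _ _ => 0)); intros b; [|apply IH].
  intros x y; apply is_pd_const.
Qed.

Lemma Ck_scal k c f : Ck k f -> Ck k (fun x y => c * f x y).
Proof. intros Hf; apply Ck_mult; [apply Ck_const | assumption]. Qed.

Lemma Ck_opp k f : Ck k f -> Ck k (fun x y => - f x y).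
Proof.
intros Hf; replace (fun x y => - f x y) with (fun x y => (-1) * f x y).
- apply Ck_scal, Hf.
- extensionality x; extensionality y; ring.
Qed.

Lemma pd_plus k b f g : Ck (S k) f -> Ck (S k) g ->
  pd b (fun x y => f x y + g x y) = fun x y => pd b f x y + pd b g x y.
Proof.
intros Hf Hg; apply is_pd_eq; intros x y.
apply is_pd_plus; apply (Ck_is_pd k); assumption.
Qed.

Lemma pd_mult k b f g : Ck (S k) f -> Ck (S k) g ->
  pd b (fun x y => f x y * g x y) = fun x y => pd b f x y * g x y + f x y * pd b g x y.
Proof.
intros Hf Hg; apply is_pd_eq; intros x y.
apply is_pd_mult; apply (Ck_is_pd k); assumption.
Qed.

Lemma pd_opp k b f : Ck (S k) f -> pd b (fun x y => - f x y) = fun x y => - pd b f x y.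
Proof.
intros Hf; apply is_pd_eq; intros x y.
apply (is_derive_ext (fun t => - sec b f x y t)); [destruct b; reflexivity|].
exact (is_derive_opp _ _ _ (Ck_is_pd k f b x y Hf)).
Qed.

Lemma Ck2_schwarz f x y : Ck 2 f -> dx (dy f) x y = dy (dx f) x y.
Proof.
intros H; apply Schwarz.
- exists (mkposreal 1 Rlt_0_1); intros u v _ _; simpl in H.
  destruct H as [_ [H [[_ [H1 _]] [_ [H2 _]]]]].
  split; [apply H|]; split; [apply H|].
  split; [apply (H2 u v) | apply (H1 u v)].
- apply (cont2_pt (dx (dy f))), (Ck_cont 0), (Ck_pd 0 _ true), (Ck_pd 1 _ false), H.
- apply (cont2_pt (dy (dx f))), (Ck_cont 0), (Ck_pd 0 _ false), (Ck_pd 1 _ true), H.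
Qed.

Lemma is_pd_RInt b F G a c x y : cont3 F -> cont3 G ->
  (forall z x y, is_pd b (F z) x y (G z x y)) ->
  is_pd b (fun x y => RInt (fun z => F z x y) a c) x y (RInt (fun z => G z x y) a c).
Proof.
intros HF HG H; unfold is_pd.
pose (f := fun u t => sec b (F t) x y u).
assert (Hf : forall u t, is_derive (fun u => f u t) u (sec b (G t) x y u)).
{ intros u t; unfold f; destruct b; simpl.
  - apply (H t u y).
  - apply (H t x u). }
apply (is_derive_ext (fun u => RInt (fun t => f u t) a c)); [destruct b; reflexivity|].
replace (RInt (fun z => G z x y) a c)
  with (RInt (fun t => Derive (fun u => f u t) (coord b x y)) a c).
- apply is_derive_RInt_param.
  + apply filter_forall; intros u t _; eexists; apply Hf.
  + intros t _.
    apply continuity_2d_pt_ext with (fun u v => sec b (G v) x y u).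
    { intros u v; symmetry; apply is_derive_unique, Hf. }
    apply continuity_2d_pt_filterlim.
    destruct b; simpl.
    * apply (cts_cont3 G (fun q : R * R => snd q) (fun q => fst q) (fun _ => y) (x, t) HG);
        [apply cts_snd | apply cts_fst | apply cts_const].
    * apply (cts_cont3 G (fun q : R * R => snd q) (fun _ => x) (fun q => fst q) (y, t) HG);
        [apply cts_snd | apply cts_const | apply cts_fst].
  + apply filter_forall; intros u; destruct b; apply (cont3_ex_RInt F); assumption.
- apply RInt_ext; intros t _; rewrite (is_derive_unique _ _ _ (Hf _ t)).
  apply sec_coord.
Qed.

(** * Compactly supported functions *)

Lemma compact_supp_pd b f : compact_supp f -> compact_supp (pd b f).
Proof.
intros [M HM]; exists M; intros x y Hxy.
assert (Hd : exists d, 0 < d /\ forall x' y', Rabs (x' - x) < d -> Rabs (y' - y) < d ->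
  f x' y' = 0).
{ destruct Hxy as [H | H]; [exists (Rabs x - M) | exists (Rabs y - M)]; (split; [lra|]);
    intros x' y' Hx Hy; apply HM; [left | right].
  - pose proof (Rabs_triang_inv x x'); rewrite (Rabs_minus_sym x x') in *; lra.
  - pose proof (Rabs_triang_inv y y'); rewrite (Rabs_minus_sym y y') in *; lra. }
destruct Hd as [d [Hd H]].
rewrite (pd_ext_loc b f (fun _ _ => 0) x y d Hd H).
apply is_pd_unique, is_pd_const.
Qed.

Lemma compact_supp_plus f g : compact_supp f -> compact_supp g ->
  compact_supp (fun x y => f x y + g x y).
Proof.
intros [M HM] [N HN]; exists (Rmax M N); intros x y H.
pose proof (Rmax_l M N); pose proof (Rmax_r M N).
rewrite HM, HN; [ring | |]; destruct H; [left | right | left | right]; lra.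
Qed.

Lemma compact_supp_opp f : compact_supp f -> compact_supp (fun x y => - f x y).
Proof. intros [M HM]; exists M; intros x y H; rewrite (HM x y H); ring. Qed.

Lemma compact_supp_mult f g : compact_supp f -> compact_supp (fun x y => f x y * g x y).
Proof. intros [M HM]; exists M; intros x y H; rewrite (HM x y H); ring. Qed.

(** The bound is encoded in the gauge: each radius is at most [/ (Rabs (f x y) + 1)], so the
    positive lower bound on the radii that compactness provides turns into an upper bound on [f] at
    the chosen centres. The final [+ 1] is the oscillation around a centre. *)
Lemma compact_supp_bounded f : cont2 f -> compact_supp f ->
  exists B, 0 < B /\ forall x y, Rabs (f x y) <= B.
Proof.
intros Hf [M HM].
assert (Hex : forall x y, exists d : posreal,
  d <= / (Rabs (f x y) + 1) /\ forall x' y', Rabs (x' - x) < d -> Rabs (y' - y) < d ->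
    Rabs (f x' y' - f x y) < 1).
{ intros x y; destruct (Hf x y 1 Rlt_0_1) as [d [Hd H]].
  assert (Hi : 0 < / (Rabs (f x y) + 1)).
  { apply Rinv_0_lt_compat; pose proof (Rabs_pos (f x y)); lra. }
  exists (mkposreal _ (Rmin_pos _ _ Hd Hi)); simpl; split; [apply Rmin_r|].
  intros; apply H; eapply Rlt_le_trans; try eassumption; apply Rmin_l. }
pose (dl := fun x y => proj1_sig (constructive_indefinite_description _ (Hex x y))).
assert (Hdl : forall x y, dl x y <= / (Rabs (f x y) + 1) /\
  forall x' y', Rabs (x' - x) < dl x y -> Rabs (y' - y) < dl x y ->
    Rabs (f x' y' - f x y) < 1).
{ intros x y; unfold dl; apply proj2_sig. }
destruct (compactness_value_2d (- M) M (- M) M dl) as [d Hd].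
assert (Hp := Rinv_0_lt_compat _ (cond_pos d)).
exists (/ d + 1); split; [lra|]; intros x y.
destruct (Rle_or_lt (Rabs x) M) as [Hx | Hx];
  [|rewrite HM, Rabs_R0 by tauto; lra].
destruct (Rle_or_lt (Rabs y) M) as [Hy | Hy];
  [|rewrite HM, Rabs_R0 by tauto; lra].
destruct (NNPP _ (Hd x y (proj1 (Rabs_le_between _ _) Hx) (proj1 (Rabs_le_between _ _) Hy)))
  as [u [v [_ [_ [Hu [Hv Hduv]]]]]].
destruct (Hdl u v) as [H1 H2]; specialize (H2 x y Hu Hv).
assert (H3 : Rabs (f u v) + 1 <= / d).
{ rewrite <- (Rinv_inv (Rabs (f u v) + 1)); apply Rinv_le_contravar; [apply cond_pos | lra]. }
replace (f x y) with ((f x y - f u v) + f u v) by ring.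
apply Rle_trans with (1 := Rabs_triang _ _); lra.
Qed.

Lemma compact_supp_unifcont f : cont2 f -> compact_supp f ->
  forall eps, 0 < eps -> exists d, 0 < d /\ forall x y x' y',
    Rabs (x' - x) < d -> Rabs (y' - y) < d -> Rabs (f x' y' - f x y) < eps.
Proof.
intros Hf [M HM] eps He.
pose (L := Rabs M + 1).
assert (HL : M < L /\ 0 < L).
{ unfold L; pose proof (Rle_abs M); pose proof (Rabs_pos M); lra. }
destruct (uniform_continuity_2d f (- (L + 1)) (L + 1) (- (L + 1)) (L + 1)
  (fun x y _ _ => cont2_pt f x y Hf) (mkposreal eps He)) as [d Hd].
exists (Rmin d 1); split; [apply Rmin_pos; [apply cond_pos | lra]|].
intros x y x' y' Hx Hy.
assert (Hx1 := Rlt_le_trans _ _ _ Hx (Rmin_l _ _)).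
assert (Hy1 := Rlt_le_trans _ _ _ Hy (Rmin_l _ _)).
assert (Hx2 := Rlt_le_trans _ _ _ Hx (Rmin_r _ _)).
assert (Hy2 := Rlt_le_trans _ _ _ Hy (Rmin_r _ _)).
apply Rabs_def2 in Hx2; apply Rabs_def2 in Hy2.
(* Coordinates less than 1 apart either both lie in the enlarged interval, where uniform continuity
   on a compact square applies, or both lie beyond [M], where [f] vanishes. *)
assert (Hcase : forall t t', -1 < t' - t < 1 ->
  (- (L + 1) <= t <= L + 1 /\ - (L + 1) <= t' <= L + 1) \/ (M < Rabs t /\ M < Rabs t')).
{ intros t t' Ht.
  destruct (Rle_or_lt t' (- L)); [|destruct (Rle_or_lt L t')].
  - destruct (Rle_or_lt t (- L)).
    + right; rewrite !Rabs_left1 by lra; lra.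
    + destruct (Rle_or_lt (- (L+1)) t'); [left; lra | exfalso; lra].
  - destruct (Rle_or_lt L t).
    + right; rewrite !Rabs_pos_eq by lra; lra.
    + destruct (Rle_or_lt t' (L+1)); [left; lra | exfalso; lra].
  - left; lra. }
destruct (Hcase x x' ltac:(lra)) as [[Hxa Hxb] | [Hxa Hxb]].
- destruct (Hcase y y' ltac:(lra)) as [[Hya Hyb] | [Hya Hyb]].
  + apply Hd; assumption.
  + rewrite !HM by tauto; rewrite Rminus_diag, Rabs_R0; assumption.
- rewrite !HM by tauto; rewrite Rminus_diag, Rabs_R0; assumption.
Qed.

(** * Smooth functions of one variable *)

Fixpoint smooth (k : nat) (f : R -> R) : Prop :=
  match k with
  | O => forall x, continuous f x
  | S k' => exists f', (forall x, is_derive f x (f' x)) /\ smooth k' f'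
  end.

Lemma is_derive_cts (f : R -> R) x l : is_derive f x l -> continuous f x.
Proof. intros H; apply (ex_derive_continuous f); exists l; exact H. Qed.

Lemma smooth_cts k f x : smooth k f -> continuous f x.
Proof.
destruct k as [|k]; simpl; [auto|].
intros [f' [H _]]; apply is_derive_cts with (f' x), H.
Qed.

Lemma smooth_pred k f : smooth (S k) f -> smooth k f.
Proof.
revert f; induction k as [|k IH]; intros f H.
- intros x; apply (smooth_cts 1), H.
- destruct H as [f' [H1 H2]]; exists f'; split; [assumption | apply IH, H2].
Qed.

Lemma smooth_const k c : smooth k (fun _ => c).
Proof.
revert c; induction k as [|k IH]; intros c; simpl.
- intros x; apply cts_const.
- exists (fun _ => 0); split; [intros x; apply (is_derive_const c x) | apply IH].
Qed.

Lemma smooth_plus k f g : smooth k f -> smooth k g -> smooth k (fun x => f x + g x).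
Proof.
revert f g; induction k as [|k IH]; intros f g Hf Hg.
- intros x; apply cts_plus; [apply Hf | apply Hg].
- destruct Hf as [f' [Hf Hf']]; destruct Hg as [g' [Hg Hg']].
  exists (fun x => f' x + g' x); split; [|apply IH; assumption].
  intros x; exact (is_derive_plus _ _ _ _ _ (Hf x) (Hg x)).
Qed.

Lemma smooth_mult k f g : smooth k f -> smooth k g -> smooth k (fun x => f x * g x).
Proof.
revert f g; induction k as [|k IH]; intros f g Hf Hg.
- intros x; apply cts_mult; [apply Hf | apply Hg].
- pose proof (smooth_pred _ _ Hf) as Hf0; pose proof (smooth_pred _ _ Hg) as Hg0.
  destruct Hf as [f' [Hf Hf']]; destruct Hg as [g' [Hg Hg']].
  exists (fun x => f' x * g x + f x * g' x); split.
  + intros x; exact (is_derive_mult _ _ _ _ _ (Hf x) (Hg x) Rmult_comm).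
  + apply smooth_plus; apply IH; assumption.
Qed.

Lemma smooth_affine k f c d : smooth k f -> smooth k (fun x => f (c * x + d)).
Proof.
assert (Ha : forall x, is_derive (fun x => c * x + d) x c).
{ intros x; auto_derive; [exact I | ring]. }
revert f; induction k as [|k IH]; intros f Hf.
- intros x; apply (cts_comp f (fun x => c * x + d)); [apply is_derive_cts with c, Ha | apply Hf].
- destruct Hf as [f' [Hf Hf']].
  exists (fun x => c * f' (c * x + d)); split.
  + intros x; exact (is_derive_comp _ _ _ _ _ (Hf _) (Ha x)).
  + apply smooth_mult; [apply smooth_const | apply IH, Hf'].
Qed.

(** Induction through [exp t = exp (t / 2) * exp (t / 2)]: one factor absorbs [(t / 2) ^ k], the
    other the remaining [t / 2]. *)
Lemma pow_le_exp k : exists C, 0 < C /\ forall t, 0 < t -> t ^ k <= C * exp t.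
Proof.
induction k as [|k [C [HC IH]]].
- exists 1; split; [lra|]; intros t Ht; simpl; pose proof (exp_ineq1_le t); lra.
- exists (2 ^ S k * C); split; [apply Rmult_lt_0_compat; [apply pow_lt; lra | assumption]|].
  intros t Ht.
  replace t with (2 * (t / 2)) at 1 by field.
  rewrite Rpow_mult_distr, Rmult_assoc.
  apply Rmult_le_compat_l; [apply pow_le; lra|].
  replace (exp t) with (exp (t / 2) * exp (t / 2)) by (rewrite <- exp_plus; f_equal; field).
  assert (H1 := IH (t / 2) ltac:(lra)).
  assert (H2 := exp_ineq1_le (t / 2)).
  simpl; rewrite Rmult_comm, <- Rmult_assoc.
  apply Rmult_le_compat; [apply pow_le; lra | lra | assumption | lra].
Qed.

(* The family [x^-n exp(-1/x)] is closed under differentiation up to linear combinations,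
   so all its members are smooth as soon as they are all differentiable at 0. *)
Definition flat (n : nat) (x : R) : R :=
  if Rle_dec x 0 then 0 else (/ x) ^ n * exp (- / x).

Lemma flat_neg n x : x <= 0 -> flat n x = 0.
Proof. intros H; unfold flat; destruct (Rle_dec x 0); [reflexivity | contradiction]. Qed.

Lemma flat_pos n x : 0 < x -> flat n x = (/ x) ^ n * exp (- / x).
Proof. intros H; unfold flat; destruct (Rle_dec x 0); [lra | reflexivity]. Qed.

(** [pow_le_exp] at [/ x] with exponent [n + 2] leaves a factor [x ^ 2] to spare. A quadratic bound
    is what sends the difference quotient at 0 to 0. *)
Lemma flat_quadratic n : exists C, 0 < C /\ forall x, 0 <= flat n x <= C * x ^ 2.
Proof.
destruct (pow_le_exp (n + 2)) as [C [HC H]].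
exists C; split; [assumption|]; intros x.
destruct (Rle_or_lt x 0) as [Hx | Hx].
- rewrite flat_neg by assumption; split; [lra|].
  apply Rmult_le_pos; [lra | apply pow2_ge_0].
- rewrite flat_pos by assumption.
  assert (Hi := Rinv_0_lt_compat x Hx).
  split; [apply Rmult_le_pos; [apply pow_le; lra | apply Rlt_le, exp_pos]|].
  specialize (H (/ x) Hi); rewrite pow_add in H.
  assert (He := exp_pos (- / x)).
  assert (H1 : exp (/ x) * exp (- / x) = 1)
    by (rewrite <- exp_plus, Rplus_opp_r; apply exp_0).
  assert (H2 : (/ x) ^ 2 * x ^ 2 = 1)
    by (rewrite <- Rpow_mult_distr, Rinv_l, pow1 by lra; reflexivity).
  assert (Hx2 : 0 < x ^ 2) by (apply pow_lt; assumption).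
  replace ((/ x) ^ n * exp (- / x))
    with ((/ x) ^ n * (/ x) ^ 2 * (exp (- / x) * x ^ 2))
    by (transitivity ((/ x) ^ n * exp (- / x) * ((/ x) ^ 2 * x ^ 2)); [ring | rewrite H2; ring]).
  replace (C * x ^ 2) with (C * exp (/ x) * (exp (- / x) * x ^ 2))
    by (transitivity (C * x ^ 2 * (exp (/ x) * exp (- / x))); [ring | rewrite H1; ring]).
  apply Rmult_le_compat_r; [|assumption].
  apply Rmult_le_pos; lra.
Qed.

Lemma is_derive_flat n x :
  is_derive (flat n) x (- INR n * flat (S n) x + flat (S (S n)) x).
Proof.
destruct (Rlt_or_le x 0) as [Hx | Hx]; [|destruct (Rle_lt_or_eq_dec 0 x Hx) as [Hx' | <-]].
- rewrite !flat_neg by lra.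
  replace (- INR n * 0 + 0) with 0 by ring.
  apply (is_derive_ext_loc (fun _ => 0)); [|exact (is_derive_const _ _)].
  exists (mkposreal (- x) ltac:(lra)); intros t Ht; symmetry; apply flat_neg.
  apply (Rabs_def2 (t - x)) in Ht; simpl in Ht; lra.
- apply (is_derive_ext_loc (fun x => (/ x) ^ n * exp (- / x))).
  { exists (mkposreal x Hx'); intros t Ht; symmetry; apply flat_pos.
    apply (Rabs_def2 (t - x)) in Ht; simpl in Ht; lra. }
  rewrite !flat_pos by assumption.
  auto_derive; [lra|].
  (* The case 0 is separate because the derivative of the power carries the exponent [pred n]. *)
  destruct n as [|n]; [simpl; field; lra|].
  rewrite Nat.pred_succ; simpl pow; field; lra.
- rewrite !flat_neg by lra.
  replace (- INR n * 0 + 0) with 0 by ring.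
  destruct (flat_quadratic n) as [C [HC H]].
  apply is_derive_Reals; intros eps He.
  assert (Hd : 0 < eps / C) by (apply Rdiv_lt_0_compat; assumption).
  exists (mkposreal _ Hd); intros h Hh0 Hh; simpl in Hh.
  rewrite Rplus_0_l, (flat_neg n 0), !Rminus_0_r by lra.
  unfold Rdiv; rewrite Rabs_mult, Rabs_inv.
  assert (Hp := Rabs_pos_lt h Hh0).
  apply Rle_lt_trans with (C * Rabs h).
  + apply Rmult_le_reg_r with (Rabs h); [assumption|].
    rewrite Rmult_assoc, Rinv_l, Rmult_1_r by lra.
    rewrite Rabs_pos_eq by apply H.
    replace (C * Rabs h * Rabs h) with (C * h ^ 2); [apply H|].
    rewrite <- (pow2_abs h); ring.
  + apply Rmult_lt_reg_r with (/ C); [apply Rinv_0_lt_compat; assumption|].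
    replace (C * Rabs h * / C) with (Rabs h) by (field; lra); exact Hh.
Qed.

Lemma smooth_flat k n : smooth k (flat n).
Proof.
revert n; induction k as [|k IH]; intros n.
- intros x; eapply is_derive_cts, is_derive_flat.
- eexists; split; [apply is_derive_flat|].
  apply smooth_plus; [apply smooth_mult; [apply smooth_const|]|]; apply IH.
Qed.

Lemma mollifier_exists : exists rho : R -> R,
  (forall k, smooth k rho) /\ (forall t, 0 <= rho t) /\
  (forall t, 1 <= Rabs t -> rho t = 0) /\ RInt rho (-1) 1 = 1.
Proof.
(* One factor vanishes for [t <= -1] and the other for [1 <= t]; between these both are positive. *)
pose (r := fun t => flat 0 (1 * t + 1) * flat 0 ((-1) * t + 1)).
assert (Hs : forall k, smooth k r).
{ intros k; apply smooth_mult; apply smooth_affine, smooth_flat. }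
assert (Hge : forall t, 0 <= flat 0 t) by (intros t; destruct (flat_quadratic 0) as [C [_ H]]; apply H).
assert (Hr : forall t, 0 <= r t) by (intros t; apply Rmult_le_pos; apply Hge).
assert (Hr0 : forall t, 1 <= Rabs t -> r t = 0).
{ intros t Ht; unfold r; unfold Rabs in Ht; destruct (Rcase_abs t).
  - rewrite (flat_neg 0 (1 * t + 1)) by lra; ring.
  - rewrite (flat_neg 0 (-1 * t + 1)) by lra; ring. }
assert (Hc : forall t, continuous r t) by (intros t; apply (smooth_cts 0), Hs).
pose (I := RInt r (-1) 1).
assert (HI : 0 < I).
{ apply RInt_gt_0; [lra | | intros t _; apply Hc].
  intros t Ht; unfold r; rewrite !flat_pos by lra; simpl.
  rewrite !Rmult_1_l; apply Rmult_lt_0_compat; apply exp_pos. }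
exists (fun t => / I * r t); split; [|split; [|split]].
- intros k; apply smooth_mult; [apply smooth_const | apply Hs].
- intros t; apply Rmult_le_pos; [apply Rlt_le, Rinv_0_lt_compat, HI | apply Hr].
- intros t Ht; rewrite (Hr0 t Ht); ring.
- apply (eq_trans (RInt_scal r (-1) 1 (/ I) (ex_RInt_cts r (-1) 1 Hc))).
  apply Rinv_l, Rgt_not_eq, HI.
Qed.

Lemma RInt_zero (f : R -> R) a b :
  (forall t, Rmin a b < t < Rmax a b -> f t = 0) -> RInt f a b = 0.
Proof.
intros H; rewrite (RInt_ext f (fun _ => 0) a b H), RInt_const.
apply Rmult_0_r.
Qed.

Lemma RInt_split (f : R -> R) a b c : (forall t, continuous f t) ->
  RInt f a c = RInt f a b + RInt f b c.
Proof.
intros H; symmetry; apply (RInt_Chasles f a b c); apply ex_RInt_cts, H.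
Qed.

Lemma is_derive_primitive (f : R -> R) a x : (forall t, continuous f t) ->
  is_derive (fun x => RInt f a x) x (f x).
Proof.
intros H; apply (is_derive_RInt f _ a x); [|apply H].
apply filter_forall; intros t; apply (@RInt_correct R_CompleteNormedModule), ex_RInt_cts, H.
Qed.

Lemma RInt_nonneg (f : R -> R) a b : a <= b -> (forall t, continuous f t) ->
  (forall t, 0 <= f t) -> 0 <= RInt f a b.
Proof. intros Hab Hc H; apply RInt_ge_0; [assumption | apply ex_RInt_cts, Hc | auto]. Qed.

Lemma plateau_exists : exists b : R -> R,
  (forall k, smooth k b) /\ (forall t, 0 <= b t <= 1) /\
  (forall t, Rabs t <= 1 -> b t = 1) /\ (forall t, 2 <= Rabs t -> b t = 0).
Proof.
destruct mollifier_exists as [rho [Hs [Hge [H0 H1]]]].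
assert (Hc : forall t, continuous rho t) by (intros t; apply (smooth_cts 0), Hs).
pose (st := fun t => RInt rho (-1) t).
assert (Hst : forall k, smooth k st).
{ intros [|k].
  - intros t; eapply is_derive_cts, is_derive_primitive, Hc.
  - exists rho; split; [intros t; apply is_derive_primitive, Hc | apply Hs]. }
assert (Hl : forall t, t <= -1 -> st t = 0).
{ intros t Ht; apply RInt_zero; rewrite Rmin_right, Rmax_left by lra.
  intros u Hu; apply H0; rewrite Rabs_left; lra. }
assert (Hr : forall t, 1 <= t -> st t = 1).
{ intros t Ht; unfold st; rewrite (RInt_split rho (-1) 1 t Hc), H1, RInt_zero; [apply Rplus_0_r|].
  rewrite Rmin_left, Rmax_right by lra.
  intros u Hu; apply H0; rewrite Rabs_pos_eq; lra. }
assert (Hb : forall t, 0 <= st t <= 1).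
{ intros t; destruct (Rle_or_lt t (-1)) as [Ht | Ht]; [rewrite Hl; lra|].
  destruct (Rle_or_lt 1 t) as [Ht' | Ht']; [rewrite Hr; lra|].
  split; [apply RInt_nonneg; [lra | assumption | assumption]|].
  rewrite <- H1, (RInt_split rho (-1) t 1 Hc); unfold st.
  pose proof (RInt_nonneg rho t 1 ltac:(lra) Hc Hge); lra. }
(* [st] climbs from 0 to 1 across [-1, 1]. The first factor is 1 up to [t = 1] and 0 from [t = 2]
   on; the second is its mirror image. *)
exists (fun t => st ((-2) * t + 3) * st (2 * t + 3)); split; [|split; [|split]].
- intros k; apply smooth_mult; apply smooth_affine, Hst.
- intros t; pose proof (Hb (-2 * t + 3)); pose proof (Hb (2 * t + 3)); nra.
- intros t Ht; apply Rabs_le_between in Ht; rewrite !Hr by lra; ring.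
- intros t Ht; unfold Rabs in Ht; destruct (Rcase_abs t).
  + rewrite (Hl (2 * t + 3)) by lra; ring.
  + rewrite (Hl (-2 * t + 3)) by lra; ring.
Qed.

(** * Soft unions *)

(* [soft_union [a1; ...; an] = 1 - (1 - a1) ... (1 - an)], which makes a cutoff function of a
   union out of cutoff functions of the members. *)
Definition soft_union (l : list R) : R := fold_right (fun a r => a + (1 - a) * r) 0 l.

Lemma soft_union_range l : (forall a, In a l -> 0 <= a <= 1) -> 0 <= soft_union l <= 1.
Proof.
induction l as [|a l IH]; simpl; intros H; [lra|].
assert (Ha := H a (or_introl eq_refl)); assert (Hl := IH (fun c Hc => H c (or_intror Hc))).
nra.
Qed.

Lemma soft_union_one l : In 1 l -> soft_union l = 1.
Proof.
induction l as [|a l IH]; simpl; [tauto|]; intros [-> | H]; [ring | rewrite IH by assumption; ring].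
Qed.

Lemma soft_union_zero l : (forall a, In a l -> a = 0) -> soft_union l = 0.
Proof.
induction l as [|a l IH]; simpl; intros H; [reflexivity|].
rewrite (H a (or_introl eq_refl)), IH by auto; ring.
Qed.

Lemma Ck_soft_union k (fs : list (R -> R -> R)) : (forall f, In f fs -> Ck k f) ->
  Ck k (fun x y => soft_union (map (fun f => f x y) fs)).
Proof.
induction fs as [|f fs IH]; simpl; intros H; [apply Ck_const|].
assert (Hf := H f (or_introl eq_refl)).
apply Ck_plus; [assumption|]; apply Ck_mult; [|apply IH; auto].
apply Ck_plus; [apply Ck_const | apply Ck_opp, Hf].
Qed.

Lemma smooth_soft_union k (fs : list (R -> R)) : (forall f, In f fs -> smooth k f) ->
  smooth k (fun x => soft_union (map (fun f => f x) fs)).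
Proof.
induction fs as [|f fs IH]; simpl; intros H; [apply smooth_const|].
assert (Hf := H f (or_introl eq_refl)).
apply smooth_plus; [assumption|]; apply smooth_mult; [|apply IH; auto].
replace (fun x => 1 - f x) with (fun x => 1 + (-1) * f x) by (extensionality x; ring).
apply smooth_plus; [apply smooth_const | apply smooth_mult; [apply smooth_const | assumption]].
Qed.

(** * Functions of one coordinate, and staircases *)

Lemma Ck_1d k (alpha : R -> R) (c : bool) : smooth k alpha -> Ck k (fun x y => alpha (coord c x y)).
Proof.
revert alpha; induction k as [|k IH]; intros alpha H.
- split; [|exact I]; apply cont2_iff; intros p.
  apply (cts_comp alpha); [|apply H].
  destruct c; [apply cts_fst | apply cts_snd].
- destruct H as [a' [H H']].
  apply (Ck_intro k _ (fun b x y => if Bool.eqb b c then a' (coord c x y) else 0)).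
  + intros b x y; unfold is_pd, sec; destruct b, c; simpl;
      solve [apply H | exact (is_derive_const (alpha y) x) | exact (is_derive_const (alpha x) y)].
  + intros b; destruct (Bool.eqb b c); [apply IH, H' | apply Ck_const].
Qed.

(** [cl] clamps an endpoint to [p, q]. The discarded pieces lie where [e] vanishes, which leaves an
    integral over a subinterval of [p, q]. *)
Lemma RInt_bump_le (e : R -> R) p q u v : p <= q -> u <= v ->
  (forall t, continuous e t) -> (forall t, 0 <= e t <= 1) ->
  (forall t, t <= p -> e t = 0) -> (forall t, q <= t -> e t = 0) ->
  RInt e u v <= q - p.
Proof.
intros Hpq Huv Hc He Hp Hq.
pose (cl := fun t => Rmax p (Rmin t q)).
assert (Hcl : forall t, RInt e t (cl t) = 0).
{ intros t; apply RInt_zero; intros z; unfold cl, Rmin, Rmax.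
  repeat destruct Rle_dec; intros Hz; solve [apply Hp; lra | apply Hq; lra | lra]. }
assert (Hcl' : RInt e (cl v) v = 0).
{ rewrite <- (Hcl v); pose proof (RInt_split e v (cl v) v Hc) as H.
  rewrite (RInt_point v e) in H; change zero with 0 in H; rewrite Hcl in *; lra. }
rewrite (RInt_split e u (cl u) v Hc), (RInt_split e (cl u) (cl v) v Hc), Hcl, Hcl'.
assert (Hle : p <= cl u <= cl v /\ cl v <= q).
{ unfold cl, Rmin, Rmax; repeat destruct Rle_dec; lra. }
assert (H := abs_RInt_le_const e (cl u) (cl v) 1 ltac:(lra) (ex_RInt_cts e _ _ Hc)).
apply Rle_trans with ((cl v - cl u) * 1); [|lra].
rewrite Rplus_0_l, Rplus_0_r; apply Rle_trans with (1 := Rle_abs _), H.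
intros t _; rewrite Rabs_pos_eq; apply He.
Qed.

(** [g] is a soft union of plateaus, one per centre [c], equal to 1 within [l] of [c] and to 0
    beyond [2 * l]; [h] is its primitive. A soft union is at most the sum of its members, so [h]
    rises by at most [4 * l] per centre. A covering of the critical values of small total length
    thus yields a small amplitude, with no control of [g']. *)
Lemma staircase_exists (cs : list R) l : 0 < l ->
  exists h g g' : R -> R,
    (forall t, is_derive h t (g t)) /\ (forall t, is_derive g t (g' t)) /\
    (forall t, continuous g' t) /\ (forall t, Rabs (g t) <= 1) /\
    (forall t, Rabs (h t) <= 4 * l * INR (length cs)) /\
    (forall c t, In c cs -> Rabs (t - c) <= l -> g t = 1).
Proof.
intros Hl.
destruct plateau_exists as [b [Hb [Hb01 [Hb1 Hb0]]]].
pose (e := fun c t => b (/ l * t + - c / l)).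
assert (Hce : forall k c, smooth k (e c)) by (intros k c; apply smooth_affine, Hb).
assert (Hel : forall c t, / l * t + - c / l = (t - c) / l) by (intros; field; lra).
assert (Heabs : forall c t, Rabs (/ l * t + - c / l) = Rabs (t - c) / l).
{ intros; rewrite Hel; unfold Rdiv; rewrite Rabs_mult, Rabs_inv, (Rabs_pos_eq l) by lra; reflexivity. }
pose (gs := fun (cs : list R) t => soft_union (map (fun f => f t) (map e cs))).
assert (Hg : forall k cs, smooth k (gs cs)).
{ intros k cs'; apply smooth_soft_union; intros f Hf.
  apply in_map_iff in Hf; destruct Hf as [c [<- _]]; apply Hce. }
assert (Hgc : forall cs t, continuous (gs cs) t) by (intros cs' t; apply (smooth_cts 0), Hg).
assert (Hg01 : forall cs t, 0 <= gs cs t <= 1).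
{ intros cs' t; apply soft_union_range; intros a Ha; rewrite map_map in Ha.
  apply in_map_iff in Ha; destruct Ha as [c [<- _]]; apply Hb01. }
assert (Hint : forall cs u v, u <= v -> RInt (gs cs) u v <= 4 * l * INR (length cs)).
{ intros cs' u v Huv; induction cs' as [|c cs' IH].
  - rewrite RInt_zero; [simpl; lra | reflexivity].
  - assert (Hc : forall t, continuous (e c) t) by (intros t; apply (smooth_cts 0), Hce).
    apply Rle_trans with (RInt (fun t => e c t + gs cs' t) u v).
    + apply RInt_le; [assumption | apply ex_RInt_cts, Hgc | |].
      * apply ex_RInt_cts; intros t; apply cts_plus; [apply Hc | apply Hgc].
      * intros t _; change (gs (c :: cs') t) with (e c t + (1 - e c t) * gs cs' t).
        pose proof (Hb01 (/ l * t + - c / l)); pose proof (Hg01 cs' t); unfold e in *; nra.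
    + replace (RInt (fun t => e c t + gs cs' t) u v)
        with (RInt (e c) u v + RInt (gs cs') u v)
        by (symmetry; exact (RInt_plus _ _ u v (ex_RInt_cts _ u v Hc) (ex_RInt_cts _ u v (Hgc cs')))).
      change (length (c :: cs')) with (S (length cs')); rewrite S_INR.
      assert (H4 : RInt (e c) u v <= (c + 2 * l) - (c - 2 * l)).
      { apply RInt_bump_le; [lra | assumption | assumption | intros; apply Hb01 | |];
          intros t Ht; apply Hb0; rewrite Heabs; apply Rmult_le_reg_r with l; try lra;
          unfold Rdiv; rewrite Rmult_assoc, Rinv_l, Rmult_1_r by lra;
          [rewrite Rabs_left1 | rewrite Rabs_pos_eq]; lra. }
      lra. }
destruct (Hg 1%nat cs) as [g' [Hg' Hg'c]].
exists (fun t => RInt (gs cs) 0 t), (gs cs), g'; split; [|split; [|split; [|split; [|split]]]].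
- intros t; apply is_derive_primitive, Hgc.
- exact Hg'.
- exact Hg'c.
- intros t; rewrite Rabs_pos_eq; apply Hg01.
- intros t; destruct (Rle_or_lt 0 t) as [Ht | Ht].
  + rewrite Rabs_pos_eq; [apply Hint, Ht|].
    apply RInt_nonneg; [assumption | apply Hgc | apply Hg01].
  + rewrite <- (opp_RInt_swap (gs cs) t 0 (ex_RInt_cts _ _ _ (Hgc cs))).
    change opp with Ropp; rewrite Rabs_Ropp, Rabs_pos_eq; [apply Hint; lra|].
    apply RInt_nonneg; [lra | apply Hgc | apply Hg01].
- intros c t Hin Ht; apply soft_union_one; rewrite map_map; apply in_map_iff.
  exists c; split; [|assumption]; apply Hb1; rewrite Heabs.
  apply Rmult_le_reg_r with l; [assumption|].
  unfold Rdiv; rewrite Rmult_assoc, Rinv_l by lra; lra.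
Qed.

(** * Mollification *)

Definition shift (c : bool) (f : R -> R -> R) (t x y : R) : R :=
  f (x - if c then t else 0) (y - if c then 0 else t).

Definition avg (rho : R -> R) (eta : R) (c : bool) (f : R -> R -> R) (x y : R) : R :=
  RInt (fun a => rho a * shift c f (eta * a) x y) (-1) 1.

(** The one-directional average with the translation moved onto the kernel, so that derivatives in
    direction [c] fall on [kappa]. Integrating over the fixed interval from [- L] to [L], which is
    to contain the support of [f] in that direction, keeps the endpoints independent of the
    point. *)
Definition conv (L : R) (c : bool) (kappa : R -> R) (f : R -> R -> R) (x y : R) : R :=
  RInt (fun a => kappa (coord c x y - a) * sec c f x y a) (- L) L.

Lemma RInt_same_support (g : R -> R) p q p' q' : (forall t, continuous g t) ->
  (forall t, t < p \/ q < t -> g t = 0) -> (forall t, t < p' \/ q' < t -> g t = 0) ->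
  RInt g p q = RInt g p' q'.
Proof.
intros Hc H H'.
rewrite (RInt_split g p p' q Hc), (RInt_split g p' q' q Hc).
rewrite (RInt_zero g p p'), (RInt_zero g q' q).
- rewrite Rplus_0_l; apply Rplus_0_r.
- intros t; unfold Rmin, Rmax; destruct (Rle_dec q' q); intros Ht;
    [apply H' | apply H]; right; lra.
- intros t; unfold Rmin, Rmax; destruct (Rle_dec p p'); intros Ht;
    [apply H' | apply H]; left; lra.
Qed.

Section Averages.
Variables (rho : R -> R) (eta : R).
Hypothesis rho_smooth : forall k, smooth k rho.
Hypothesis rho_ge0 : forall t, 0 <= rho t.
Hypothesis rho_supp : forall t, 1 <= Rabs t -> rho t = 0.
Hypothesis rho_mass : RInt rho (-1) 1 = 1.
Hypothesis eta_gt0 : 0 < eta.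

Lemma rho_cts t : continuous rho t.
Proof. apply (smooth_cts 0), rho_smooth. Qed.

Lemma avg_integrand_cont3 c f : cont2 f ->
  cont3 (fun a x y => rho a * shift c f (eta * a) x y).
Proof.
intros Hf p; apply cts_mult.
- apply (cts_comp rho); [apply cts_fst | apply rho_cts].
- apply (cts_cont2 f); [assumption | |]; apply cts_minus;
    try apply cts_fst_snd; try apply cts_snd_snd; destruct c; try apply cts_const;
    (apply cts_mult; [apply cts_const | apply cts_fst]).
Qed.

Lemma avg_cont2 c f : cont2 f -> cont2 (avg rho eta c f).
Proof.
intros Hf; apply (cont2_RInt (fun a x y => rho a * shift c f (eta * a) x y)); [lra|].
apply avg_integrand_cont3, Hf.
Qed.

Lemma is_pd_shift b c f g t x y : (forall x y, is_pd b f x y (g x y)) ->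
  is_pd b (shift c f t) x y (shift c g t x y).
Proof.
intros H; unfold is_pd, shift, sec, coord.
assert (Hs : forall s z, is_derive (fun u => u - s) z 1).
{ intros s z; auto_derive; [exact I | ring]. }
destruct b.
- rewrite <- (Rmult_1_l (g _ _)).
  exact (is_derive_comp (fun u => f u (y - (if c then 0 else t))) (fun u => u - _) x _ _
    (H (x - (if c then t else 0)) (y - (if c then 0 else t))) (Hs _ x)).
- rewrite <- (Rmult_1_l (g _ _)).
  exact (is_derive_comp (fun u => f (x - (if c then t else 0)) u) (fun u => u - _) y _ _
    (H (x - (if c then t else 0)) (y - (if c then 0 else t))) (Hs _ y)).
Qed.

Lemma is_pd_avg b c f g x y : cont2 f -> cont2 g ->
  (forall x y, is_pd b f x y (g x y)) -> is_pd b (avg rho eta c f) x y (avg rho eta c g x y).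
Proof.
intros Hf Hg H.
apply (is_pd_RInt b (fun a x y => rho a * shift c f (eta * a) x y)
  (fun a x y => rho a * shift c g (eta * a) x y)).
- apply avg_integrand_cont3, Hf.
- apply avg_integrand_cont3, Hg.
- intros a u v.
  eapply is_pd_change.
  + apply is_pd_mult; [apply is_pd_const | apply is_pd_shift, H].
  + simpl; ring.
Qed.

Lemma pd_avg b c f : Ck 1 f -> pd b (avg rho eta c f) = avg rho eta c (pd b f).
Proof.
intros Hf; apply is_pd_eq; intros x y; apply is_pd_avg.
- apply (Ck_cont 1), Hf.
- apply (Ck_cont 0), Ck_pd, Hf.
- intros u v; apply (Ck_is_pd 0), Hf.
Qed.

Lemma avg_Ck1 c f : Ck 1 f -> Ck 1 (avg rho eta c f).
Proof.
intros Hf; apply (Ck_intro 0 _ (fun b => avg rho eta c (pd b f))); intros b.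
- intros x y; apply is_pd_avg.
  + apply (Ck_cont 1), Hf.
  + apply (Ck_cont 0), Ck_pd, Hf.
  + intros u v; apply (Ck_is_pd 0), Hf.
- split; [|exact I]; apply avg_cont2, (Ck_cont 0), Ck_pd, Hf.
Qed.

Lemma avg_opp c f : cont2 f -> avg rho eta c (fun x y => - f x y) = fun x y => - avg rho eta c f x y.
Proof.
intros Hf; extensionality x; extensionality y; unfold avg.
apply (eq_trans (y := RInt (fun a => opp (rho a * shift c f (eta * a) x y)) (-1) 1)).
- apply RInt_ext; intros a _; symmetry; apply Ropp_mult_distr_r.
- apply (RInt_opp (fun a => rho a * shift c f (eta * a) x y)).
  apply (cont3_ex_RInt (fun a x y => rho a * shift c f (eta * a) x y)), avg_integrand_cont3, Hf.
Qed.

Lemma shift_box (c : bool) a x y : -1 <= a <= 1 ->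
  Rabs (x - (if c then eta * a else 0) - x) <= eta /\
  Rabs (y - (if c then 0 else eta * a) - y) <= eta.
Proof.
intros Ha; assert (- eta <= eta * a <= eta) by nra.
split; apply Rabs_le_between; destruct c; lra.
Qed.

(** As [rho] is a probability density, pointwise bounds pass to the average. Two functions occur so
    that the estimate can be iterated: [g] may be an average already taken in the other direction,
    within [e1] of [f]. *)
Lemma avg_close c f g e1 e2 x y : cont2 g ->
  (forall x y, Rabs (g x y - f x y) <= e1) ->
  (forall x', forall y', Rabs (x' - x) <= eta -> Rabs (y' - y) <= eta ->
     Rabs (f x' y' - f x y) <= e2) ->
  Rabs (avg rho eta c g x y - f x y) <= e1 + e2.
Proof.
intros Hg H1 H2.
assert (Hc := rho_cts).
assert (Hex : ex_RInt (fun a => rho a * shift c g (eta * a) x y) (-1) 1).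
{ apply (cont3_ex_RInt (fun a x y => rho a * shift c g (eta * a) x y)), avg_integrand_cont3, Hg. }
assert (Hpt : forall a, -1 < a < 1 ->
  f x y - (e1 + e2) <= shift c g (eta * a) x y <= f x y + (e1 + e2)).
{ intros a Ha; destruct (shift_box c a x y ltac:(lra)) as [Hx Hy].
  specialize (H1 (x - if c then eta * a else 0) (y - if c then 0 else eta * a)).
  specialize (H2 _ _ Hx Hy).
  apply Rabs_le_between in H1; apply Rabs_le_between in H2; unfold shift; lra. }
assert (Hk : forall k, RInt (fun a => rho a * k) (-1) 1 = k).
{ intros k; rewrite (RInt_ext _ (fun a => scal k (rho a))).
  - apply (eq_trans (RInt_scal rho (-1) 1 k (ex_RInt_cts rho (-1) 1 Hc))).
    rewrite rho_mass; apply Rmult_1_r.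
  - intros a _; apply Rmult_comm. }
assert (Hek : forall k, ex_RInt (fun a => rho a * k) (-1) 1).
{ intros k; apply ex_RInt_cts; intros a; apply cts_mult; [apply Hc | apply cts_const]. }
assert (Hlo : f x y - (e1 + e2) <= avg rho eta c g x y).
{ rewrite <- (Hk (f x y - (e1 + e2))); apply RInt_le; [lra | apply Hek | exact Hex |].
  intros a Ha; apply Rmult_le_compat_l; [apply rho_ge0 | apply Hpt, Ha]. }
assert (Hup : avg rho eta c g x y <= f x y + (e1 + e2)).
{ rewrite <- (Hk (f x y + (e1 + e2))); apply RInt_le; [lra | exact Hex | apply Hek |].
  intros a Ha; apply Rmult_le_compat_l; [apply rho_ge0 | apply Hpt, Ha]. }
apply Rabs_le_between; lra.
Qed.

Lemma avg_zero c f x y :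
  (forall t, Rabs t <= eta -> shift c f t x y = 0) -> avg rho eta c f x y = 0.
Proof.
intros H; apply RInt_zero; rewrite Rmin_left, Rmax_right by lra; intros a Ha.
rewrite H; [ring|].
apply Rabs_le_between; nra.
Qed.

Lemma avg_conv L c f : cont2 f -> (forall x y, L < Rabs (coord c x y) -> f x y = 0) ->
  avg rho eta c f = conv L c (fun t => / eta * rho (/ eta * t + 0)) f.
Proof.
intros Hf HL; extensionality x; extensionality y; unfold avg, conv.
set (X := coord c x y).
pose (g := fun a => / eta * rho (/ eta * (X - a) + 0) * sec c f x y a).
assert (Hsc : forall t, continuous (sec c f x y) t).
{ intros t; destruct c; simpl.
  - apply (cts_cont2 f (fun a => a) (fun _ => y)); [assumption | apply continuous_id | apply cts_const].
  - apply (cts_cont2 f (fun _ => x) (fun a => a)); [assumption | apply cts_const | apply continuous_id]. }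
assert (Hgc : forall t, continuous g t).
{ intros t; apply cts_mult; [|apply Hsc].
  apply cts_mult; [apply cts_const|].
  apply (cts_comp rho); [|apply rho_cts].
  apply cts_plus; [|apply cts_const]; apply cts_mult; [apply cts_const|].
  apply cts_minus; [apply cts_const | apply continuous_id]. }
change (RInt (fun a => rho a * shift c f (eta * a) x y) (-1) 1 = RInt g (- L) L).
(* Both intervals contain the support of [g]: off the first the kernel vanishes, off the second [f]
   does. The substitution [t = X - eta * a] then reverses the orientation, and this sign cancels the
   one in its slope [- eta]. *)
rewrite <- (RInt_same_support g (X - eta) (X + eta) (- L) L Hgc).
- pose (phi := fun a => - eta * g (- eta * a + X)).
  assert (Hphi : forall t, continuous phi t).
  { intros t; apply cts_mult; [apply cts_const|].
    apply (cts_comp g); [|apply Hgc].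
    apply cts_plus; [|apply cts_const]; apply cts_mult; [apply cts_const | apply continuous_id]. }
  assert (H1 : RInt phi (-1) 1 = RInt g (X + eta) (X - eta)).
  { replace (X + eta) with (- eta * -1 + X) by ring.
    replace (X - eta) with (- eta * 1 + X) by ring.
    exact (RInt_comp_lin g (- eta) X (-1) 1 (ex_RInt_cts g _ _ Hgc)). }
  assert (H2 : RInt g (X - eta) (X + eta) = - RInt g (X + eta) (X - eta))
    by (symmetry; exact (opp_RInt_swap g _ _ (ex_RInt_cts g _ _ Hgc))).
  assert (H3 : RInt (fun a => - phi a) (-1) 1 = - RInt phi (-1) 1)
    by (exact (RInt_opp phi (-1) 1 (ex_RInt_cts phi _ _ Hphi))).
  rewrite H2, <- H1, <- H3.
  apply RInt_ext; intros a _; unfold phi, g.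
  replace (/ eta * (X - (- eta * a + X)) + 0) with a by (field; lra).
  replace (shift c f (eta * a) x y) with (sec c f x y (- eta * a + X)).
  + change (@eq R (rho a * sec c f x y (- eta * a + X))
      (- (- eta * (/ eta * rho a * sec c f x y (- eta * a + X))))); field; lra.
  + unfold shift, sec, X, coord; destruct c; f_equal; ring.
- intros t Ht; unfold g; rewrite rho_supp; [ring|].
  rewrite Rplus_0_r, Rabs_mult, (Rabs_pos_eq (/ eta)) by (apply Rlt_le, Rinv_0_lt_compat, eta_gt0).
  apply Rmult_le_reg_l with eta; [assumption|].
  rewrite <- Rmult_assoc, Rinv_r, Rmult_1_l, Rmult_1_r by lra.
  destruct Ht; [rewrite Rabs_pos_eq | rewrite Rabs_left]; lra.
- intros t Ht; unfold g.
  assert (H0 : L < Rabs t).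
  { destruct Ht; unfold Rabs; destruct (Rcase_abs t); lra. }
  replace (sec c f x y t) with 0; [ring|].
  symmetry; destruct c; apply HL; exact H0.
Qed.

End Averages.

(** * Convolution with smooth kernels *)

Lemma conv_integrand_cont3 c kappa f : (forall t, continuous kappa t) -> cont2 f ->
  cont3 (fun a x y => kappa (coord c x y - a) * sec c f x y a).
Proof.
intros Hk Hf p; apply cts_mult.
- apply (cts_comp kappa); [|apply Hk].
  apply cts_minus; [destruct c; [apply cts_fst_snd | apply cts_snd_snd] | apply cts_fst].
- destruct c; simpl; apply (cts_cont2 f); try assumption;
    solve [apply cts_fst | apply cts_fst_snd | apply cts_snd_snd].
Qed.

Lemma conv_cont2 L c kappa f : 0 <= L -> (forall t, continuous kappa t) -> cont2 f ->
  cont2 (conv L c kappa f).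
Proof.
intros HL Hk Hf.
apply (cont2_RInt (fun a x y => kappa (coord c x y - a) * sec c f x y a)); [lra|].
apply conv_integrand_cont3; assumption.
Qed.

Lemma is_pd_conv_kernel L c kappa kappa' f x y : cont2 f ->
  (forall t, is_derive kappa t (kappa' t)) -> (forall t, continuous kappa' t) ->
  is_pd c (conv L c kappa f) x y (conv L c kappa' f x y).
Proof.
intros Hf Hk Hk'.
apply (is_pd_RInt c (fun a x y => kappa (coord c x y - a) * sec c f x y a)
  (fun a x y => kappa' (coord c x y - a) * sec c f x y a)).
- apply conv_integrand_cont3; [|assumption].
  intros t; apply is_derive_cts with (kappa' t), Hk.
- apply conv_integrand_cont3; assumption.
- intros a u v.
  eapply is_pd_change.
  + apply is_pd_mult.
    * apply (is_pd_comp c kappa (fun x y => coord c x y - a) u v 1); [apply Hk|].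
      unfold is_pd, sec, coord; destruct c; auto_derive; trivial; ring.
    * unfold is_pd, sec, coord; destruct c.
      -- exact (is_derive_const (f a v) u).
      -- exact (is_derive_const (f u a) v).
  + change zero with 0; simpl; ring.
Qed.

Lemma is_pd_conv_fun L c kappa f g x y : cont2 f -> cont2 g ->
  (forall t, continuous kappa t) -> (forall x y, is_pd (negb c) f x y (g x y)) ->
  is_pd (negb c) (conv L c kappa f) x y (conv L c kappa g x y).
Proof.
intros Hf Hg Hk H.
apply (is_pd_RInt (negb c) (fun a x y => kappa (coord c x y - a) * sec c f x y a)
  (fun a x y => kappa (coord c x y - a) * sec c g x y a)).
- apply conv_integrand_cont3; assumption.
- apply conv_integrand_cont3; assumption.
- intros a u v.
  eapply is_pd_change.
  + apply (is_pd_mult (negb c) _ _ u v 0 (sec c g u v a)).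
    * unfold is_pd, sec, coord; destruct c; simpl.
      -- exact (is_derive_const (kappa (u - a)) v).
      -- exact (is_derive_const (kappa (v - a)) u).
    * unfold is_pd, sec, coord; destruct c; simpl; [apply (H a v) | apply (H u a)].
  + change zero with 0; simpl; ring.
Qed.

(** Every derivative is absorbed by a kernel: one in y falls on the outer [lambda], one in x passes
    through the outer convolution and falls on [kappa]. The function [f] stays untouched, so the
    induction generalizes over the two kernels only. *)
Lemma conv_conv_Ck L k kappa lambda f : 0 <= L -> cont2 f ->
  smooth k kappa -> smooth k lambda -> Ck k (conv L false lambda (conv L true kappa f)).
Proof.
intros HL Hf; revert kappa lambda; induction k as [|k IH]; intros kappa lambda Hk Hl.
- split; [|exact I]; apply conv_cont2; [assumption | exact Hl|].
  apply conv_cont2; assumption.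
- pose proof (smooth_pred _ _ Hk) as Hk0; pose proof (smooth_pred _ _ Hl) as Hl0.
  destruct Hk as [kappa' [Hk Hk']]; destruct Hl as [lambda' [Hl Hl']].
  apply (Ck_intro k _ (fun b => if b then conv L false lambda (conv L true kappa' f)
                                 else conv L false lambda' (conv L true kappa f))).
  + intros [] x y.
    * apply (is_pd_conv_fun L false); try (apply conv_cont2); try assumption;
        try (intros t; eapply smooth_cts; eassumption).
      intros u v; apply is_pd_conv_kernel; try assumption.
      intros t; eapply smooth_cts; eassumption.
    * apply is_pd_conv_kernel; try assumption.
      -- apply conv_cont2; try assumption; intros t; eapply smooth_cts; eassumption.
      -- intros t; eapply smooth_cts; eassumption.
  + intros []; apply IH; assumption.
Qed.

(** A tensor-product mollifier, known afterwards only through these properties. Commuting with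
    derivatives and with negation is enough to preserve [div = 0]. The error [2 * e] is one [e] for
    each of the two directional averages. *)
Lemma mollifier_operator eta : 0 < eta -> exists T : (R -> R -> R) -> R -> R -> R,
  (forall f, cont2 f -> compact_supp f -> Cinf (T f)) /\
  (forall b f, Ck 1 f -> pd b (T f) = T (pd b f)) /\
  (forall f, cont2 f -> T (fun x y => - f x y) = fun x y => - T f x y) /\
  (forall f x y, (forall x' y', Rabs (x' - x) <= eta -> Rabs (y' - y) <= eta -> f x' y' = 0) ->
     T f x y = 0) /\
  (forall f e, cont2 f -> (forall x y x' y', Rabs (x' - x) <= eta -> Rabs (y' - y) <= eta ->
     Rabs (f x' y' - f x y) <= e) -> forall x y, Rabs (T f x y - f x y) <= 2 * e).
Proof.
intros Heta; destruct mollifier_exists as [rho [Hs [Hge [H0 H1]]]].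
exists (fun f => avg rho eta false (avg rho eta true f)).
split; [|split; [|split; [|split]]].
- intros f Hf [M HM] k.
  assert (HM' : forall x y, Rabs M < Rabs x \/ Rabs M < Rabs y -> f x y = 0).
  { pose proof (Rle_abs M); intros x y [H' | H']; apply HM; [left | right]; lra. }
  rewrite (avg_conv rho eta Hs H0 Heta (Rabs M) false).
  + rewrite (avg_conv rho eta Hs H0 Heta (Rabs M) true); [|assumption|].
    * apply conv_conv_Ck; [apply Rabs_pos | assumption | |];
        (apply smooth_mult; [apply smooth_const | apply smooth_affine, Hs]).
    * intros x y Hx; apply HM'; left; exact Hx.
  + apply avg_cont2; assumption.
  + intros x y Hy; apply avg_zero; [assumption|]; intros t _; unfold shift.
    apply HM'; right; rewrite Rminus_0_r; exact Hy.
- intros b f Hf; rewrite pd_avg; [|assumption|apply avg_Ck1; assumption].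
  rewrite pd_avg by assumption; reflexivity.
- intros f Hf; rewrite !avg_opp; try assumption; [reflexivity|].
  apply avg_cont2; assumption.
- intros f x y H; apply avg_zero; [assumption|]; intros t Ht.
  unfold shift at 1; apply avg_zero; [assumption|]; intros t' Ht'; unfold shift.
  apply H; rewrite !Rminus_0_r.
  + replace (x - t' - x) with (- t') by ring; rewrite Rabs_Ropp; assumption.
  + replace (y - t - y) with (- t) by ring; rewrite Rabs_Ropp; assumption.
- intros f e Hf He x y.
  replace (2 * e) with (e + e) by ring.
  apply avg_close; try assumption.
  + apply avg_cont2; assumption.
  + intros u v; rewrite <- (Rplus_0_l e); apply avg_close; try assumption.
    * intros; rewrite Rminus_diag, Rabs_R0; lra.
    * apply He.
  + apply He.
Qed.

(** * Compact sets, cutoff functions and critical values *)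

Lemma Rabs_diff_triang a b c : Rabs (a - c) <= Rabs (a - b) + Rabs (b - c).
Proof. replace (a - c) with ((a - b) + (b - c)) by ring; apply Rabs_triang. Qed.

Lemma open2_box x0 y0 r : open2 (fun x y => Rabs (x - x0) < r /\ Rabs (y - y0) < r).
Proof.
intros x y [Hx Hy].
exists (Rmin (r - Rabs (x - x0)) (r - Rabs (y - y0))); split; [apply Rmin_pos; lra|].
intros x' y' Hx' Hy'.
pose proof (Rmin_l (r - Rabs (x - x0)) (r - Rabs (y - y0))).
pose proof (Rmin_r (r - Rabs (x - x0)) (r - Rabs (y - y0))).
pose proof (Rabs_diff_triang x' x x0); pose proof (Rabs_diff_triang y' y y0); lra.
Qed.

Lemma list_lower_bound {T : Type} (w : T -> R) (l : list T) : (forall i, 0 < w i) ->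
  exists d, 0 < d /\ forall i, In i l -> d <= w i.
Proof.
intros H; induction l as [|i l [d [Hd IH]]]; [exists 1; split; [lra | intros i []]|].
exists (Rmin d (w i)); split; [apply Rmin_pos; auto|].
intros j [<- | Hj]; [apply Rmin_r | eapply Rle_trans; [apply Rmin_l | auto]].
Qed.

(** The Lebesgue number of a cover by boxes whose doubles lie in [U]: a point of [K] is within one
    radius of some centre, so a move shorter than the least radius stays in the double. The index
    type carries the inclusion of the double. *)
Lemma compact2_lebesgue K U : compact2 K -> open2 U -> (forall x y, K x y -> U x y) ->
  exists d, 0 < d /\ forall x y x' y', K x y -> Rabs (x' - x) <= d -> Rabs (y' - y) <= d -> U x' y'.
Proof.
intros HK HU HKU.
pose (I := {w : R * R * R | 0 < snd w /\ forall x' y',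
  Rabs (x' - fst (fst w)) < 2 * snd w -> Rabs (y' - snd (fst w)) < 2 * snd w -> U x' y'}).
destruct (HK I (fun i x y => Rabs (x - fst (fst (proj1_sig i))) < snd (proj1_sig i) /\
  Rabs (y - snd (fst (proj1_sig i))) < snd (proj1_sig i))) as [l Hl].
- intros i; apply open2_box.
- intros x y Hxy; destruct (HU x y (HKU x y Hxy)) as [d [Hd H]].
  assert (Hw : 0 < snd (x, y, d / 2) /\ forall x' y',
    Rabs (x' - fst (fst (x, y, d / 2))) < 2 * snd (x, y, d / 2) ->
    Rabs (y' - snd (fst (x, y, d / 2))) < 2 * snd (x, y, d / 2) -> U x' y').
  { simpl; split; [lra|]; intros x' y' Hx' Hy'; apply H; lra. }
  exists (exist _ (x, y, d / 2) Hw : I); simpl.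
  rewrite !Rminus_diag, Rabs_R0; lra.
- destruct (list_lower_bound (fun i : I => snd (proj1_sig i)) l) as [d [Hd Hmin]].
  { intros i; apply (proj2_sig i). }
  exists (d / 2); split; [lra|]; intros x y x' y' Hxy Hx Hy.
  destruct (Hl x y Hxy) as [i [Hi [Hix Hiy]]].
  specialize (Hmin i Hi); simpl in Hmin.
  apply (proj2_sig i).
  + pose proof (Rabs_diff_triang x' x (fst (fst (proj1_sig i)))); lra.
  + pose proof (Rabs_diff_triang y' y (snd (fst (proj1_sig i)))); lra.
Qed.

Lemma compact2_bounded K : compact2 K ->
  exists M, 0 < M /\ forall x y, K x y -> Rabs x <= M /\ Rabs y <= M.
Proof.
intros HK.
destruct (HK nat (fun n x y => Rabs (x - 0) < INR n /\ Rabs (y - 0) < INR n)) as [l Hl].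
- intros n; apply open2_box.
- intros x y _.
  destruct (nfloor_ex (Rabs x) (Rabs_pos x)) as [n Hn].
  destruct (nfloor_ex (Rabs y) (Rabs_pos y)) as [m Hm].
  exists (S n + S m)%nat; rewrite !Rminus_0_r, plus_INR, !S_INR.
  pose proof (pos_INR n); pose proof (pos_INR m); lra.
- exists (INR (list_max l) + 1); split; [pose proof (pos_INR (list_max l)); lra|].
  intros x y Hxy; destruct (Hl x y Hxy) as [n [Hn [Hx Hy]]].
  rewrite Rminus_0_r in Hx, Hy.
  assert (Hle : (n <= list_max l)%nat).
  { assert (H := proj1 (list_max_le l (list_max l)) (le_n _)).
    rewrite Forall_forall in H; auto. }
  apply le_INR in Hle; lra.
Qed.

Lemma compact_supp_soft_union (fs : list (R -> R -> R)) :
  (forall f, In f fs -> compact_supp f) ->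
  compact_supp (fun x y => soft_union (map (fun f => f x y) fs)).
Proof.
induction fs as [|f fs IH]; simpl; intros H; [exists 0; reflexivity|].
destruct (compact_supp_plus _ _ (H f (or_introl eq_refl))
  (compact_supp_mult _ (fun x y => 1 - f x y) (IH (fun g Hg => H g (or_intror Hg)))))
  as [M HM].
exists M; intros x y Hxy; rewrite <- (HM x y Hxy); ring.
Qed.

(** A soft union of box-shaped bumps centred on [K]. The closing dichotomy has a margin [r] on both
    sides, because the later estimate of a gradient at a point uses second-derivative bounds on a
    whole box around it. *)
Lemma cutoff_exists K U : compact2 K -> open2 U -> (forall x y, K x y -> U x y) ->
  exists chi r, 0 < r /\ Ck 2 chi /\ compact_supp chi /\
    (forall x y, 0 <= chi x y <= 1) /\
    (forall x y, K x y -> exists d, 0 < d /\ forall x' y', Rabs (x' - x) < d ->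
       Rabs (y' - y) < d -> chi x' y' = 1) /\
    (forall x y,
       (forall x' y', Rabs (x' - x) <= r -> Rabs (y' - y) <= r -> U x' y') \/
       (forall x' y', Rabs (x' - x) < r -> Rabs (y' - y) < r -> chi x' y' = 0)).
Proof.
intros HK HU HKU.
destruct (compact2_lebesgue K U HK HU HKU) as [d [Hd HdU]].
(* Bumps vanish beyond [2 * r] from their centres. A point within [3 * r] of a centre has its
   [r]-box within [4 * r = d] of [K], hence in [U]; around any other point the [r]-box meets no
   bump. *)
pose (r := d / 4); assert (Hr : 0 < r) by (unfold r; lra).
pose (I := {p : R * R | K (fst p) (snd p)}).
destruct (HK I (fun i x y => Rabs (x - fst (proj1_sig i)) < r /\ Rabs (y - snd (proj1_sig i)) < r))
  as [l Hl].
{ intros i; apply open2_box. }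
{ intros x y Hxy; exists (exist _ (x, y) Hxy : I); simpl; rewrite !Rminus_diag, Rabs_R0; lra. }
destruct plateau_exists as [b [Hb [Hb01 [Hb1 Hb0]]]].
pose (beta := fun (i : I) x y =>
  b (/ r * x + - fst (proj1_sig i) / r) * b (/ r * y + - snd (proj1_sig i) / r)).
assert (Habs : forall t c, Rabs (/ r * t + - c / r) = Rabs (t - c) / r).
{ intros t c; replace (/ r * t + - c / r) with ((t - c) / r) by (field; lra).
  unfold Rdiv; rewrite Rabs_mult, Rabs_inv, (Rabs_pos_eq r) by lra; reflexivity. }
assert (Hin : forall t c, Rabs (t - c) <= r -> b (/ r * t + - c / r) = 1).
{ intros t c H; apply Hb1; rewrite Habs; apply Rmult_le_reg_r with r; [assumption|].
  unfold Rdiv; rewrite Rmult_assoc, Rinv_l by lra; lra. }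
assert (Hout : forall t c, 2 * r <= Rabs (t - c) -> b (/ r * t + - c / r) = 0).
{ intros t c H; apply Hb0; rewrite Habs; apply Rmult_le_reg_r with r; [assumption|].
  unfold Rdiv; rewrite Rmult_assoc, Rinv_l by lra; lra. }
exists (fun x y => soft_union (map (fun f => f x y) (map beta l))), r.
split; [assumption|]; split; [|split; [|split; [|split]]].
- apply Ck_soft_union; intros f Hf; apply in_map_iff in Hf; destruct Hf as [i [<- _]].
  apply Ck_mult.
  + apply (Ck_1d 2 (fun t => b (/ r * t + - fst (proj1_sig i) / r)) true), smooth_affine, Hb.
  + apply (Ck_1d 2 (fun t => b (/ r * t + - snd (proj1_sig i) / r)) false), smooth_affine, Hb.
- apply compact_supp_soft_union; intros f Hf; apply in_map_iff in Hf; destruct Hf as [i [<- _]].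
  exists (Rabs (fst (proj1_sig i)) + Rabs (snd (proj1_sig i)) + 2 * r).
  pose proof (Rabs_pos (fst (proj1_sig i))); pose proof (Rabs_pos (snd (proj1_sig i))).
  intros x y [Hx | Hy]; unfold beta.
  + rewrite (Hout x); [ring|]; pose proof (Rabs_triang_inv x (fst (proj1_sig i))); lra.
  + rewrite (Hout y); [ring|]; pose proof (Rabs_triang_inv y (snd (proj1_sig i))); lra.
- intros x y; apply soft_union_range; intros a Ha; rewrite map_map in Ha.
  apply in_map_iff in Ha; destruct Ha as [i [<- _]]; unfold beta.
  pose proof (Hb01 (/ r * x + - fst (proj1_sig i) / r)).
  pose proof (Hb01 (/ r * y + - snd (proj1_sig i) / r)); nra.
- intros x y Hxy; destruct (Hl x y Hxy) as [i [Hi Hib]].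
  destruct (open2_box _ _ _ x y Hib) as [d' [Hd' H]].
  exists d'; split; [assumption|]; intros x' y' Hx' Hy'.
  destruct (H x' y' Hx' Hy') as [H1 H2].
  apply soft_union_one; rewrite map_map; apply in_map_iff; exists i; split; [|assumption].
  unfold beta; rewrite !Hin by lra; ring.
- intros x y.
  destruct (classic (exists i, In i l /\ Rabs (x - fst (proj1_sig i)) <= 3 * r /\
    Rabs (y - snd (proj1_sig i)) <= 3 * r)) as [[i [Hi [Hx Hy]]] | Hno].
  + left; intros x' y' Hx' Hy'; apply (HdU _ _ _ _ (proj2_sig i)); unfold r in *.
    * pose proof (Rabs_diff_triang x' x (fst (proj1_sig i))); lra.
    * pose proof (Rabs_diff_triang y' y (snd (proj1_sig i))); lra.
  + right; intros x' y' Hx' Hy'; apply soft_union_zero; intros a Ha; rewrite map_map in Ha.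
    apply in_map_iff in Ha; destruct Ha as [i [<- Hi]]; unfold beta.
    rewrite Rabs_minus_sym in Hx', Hy'.
    destruct (Rle_or_lt (Rabs (x - fst (proj1_sig i))) (3 * r)) as [Hx | Hx].
    * destruct (Rle_or_lt (Rabs (y - snd (proj1_sig i))) (3 * r)) as [Hy | Hy].
      -- exfalso; apply Hno; exists i; auto.
      -- rewrite (Hout y'); [ring|].
         pose proof (Rabs_diff_triang y y' (snd (proj1_sig i))); lra.
    * rewrite (Hout x'); [ring|].
      pose proof (Rabs_diff_triang x x' (fst (proj1_sig i))); lra.
Qed.

Lemma bool2_common_radius (P : bool -> bool -> R -> Prop) :
  (forall b c d d', d' <= d -> P b c d -> P b c d') ->
  (forall b c, exists d, 0 < d /\ P b c d) -> exists d, 0 < d /\ forall b c, P b c d.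
Proof.
intros Hmon H.
destruct (H true true) as [d1 [H1 P1]]; destruct (H true false) as [d2 [H2 P2]].
destruct (H false true) as [d3 [H3 P3]]; destruct (H false false) as [d4 [H4 P4]].
exists (Rmin (Rmin d1 d2) (Rmin d3 d4)); split; [repeat apply Rmin_pos; assumption|].
pose proof (Rmin_l (Rmin d1 d2) (Rmin d3 d4)); pose proof (Rmin_r (Rmin d1 d2) (Rmin d3 d4)).
pose proof (Rmin_l d1 d2); pose proof (Rmin_r d1 d2).
pose proof (Rmin_l d3 d4); pose proof (Rmin_r d3 d4).
intros [] []; [apply (Hmon true true d1) | apply (Hmon true false d2)
  | apply (Hmon false true d3) | apply (Hmon false false d4)]; solve [assumption | lra].
Qed.

(* An elementary Morse-Sard theorem: since the second derivatives of [psi] vanish on [K] too,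
   [psi] varies by at most [o(side^2)] on the part of [K] in a grid cell. *)
Lemma critical_values_null K psi (v : bool -> R -> R -> R) :
  compact2 K -> (forall b, Ck 1 (v b)) -> (forall b, compact_supp (v b)) ->
  (forall b x y, is_pd b psi x y (v b x y)) ->
  (forall x y, K x y -> forall b, v b x y = 0 /\ forall c, pd c (v b) x y = 0) ->
  forall m, 0 < m -> exists cs l, 0 < l /\ l * INR (length cs) <= m /\
    forall x y, K x y -> exists c, In c cs /\ Rabs (psi x y - c) < l.
Proof.
intros HK Hv Hsupp Hpsi H0 m Hm.
destruct (compact2_bounded K HK) as [M [HM HKM]].
assert (HMM : 0 < 80 * M * M) by nra.
(* There are [(N + 1)^2 <= (2 * N)^2] cells, each charged [5 * eta * ell^2]. As [N * ell = 2 * M],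
   the total is at most [5 * eta * (4 * M)^2 = 80 * M^2 * eta = m]. *)
pose (eta := m / (80 * M * M)); assert (Heta : 0 < eta) by (apply Rdiv_lt_0_compat; assumption).
destruct (bool2_common_radius (fun b c d => forall x y x' y', Rabs (x' - x) < d ->
  Rabs (y' - y) < d -> Rabs (pd c (v b) x' y' - pd c (v b) x y) < eta)) as [d [Hd Huc]].
{ intros b c d d' Hdd' H x y x' y' Hx Hy; apply H; lra. }
{ intros b c; apply compact_supp_unifcont; [|apply compact_supp_pd, Hsupp | assumption].
  apply (Ck_cont 0), Ck_pd, Hv. }
destruct (nfloor_ex (2 * M / d)) as [n Hn].
{ apply Rlt_le, Rdiv_lt_0_compat; lra. }
pose (N := S n); assert (HN : 2 * M / d < INR N) by (unfold N; rewrite S_INR; lra).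
assert (HN1 : 1 <= INR N) by (unfold N; rewrite S_INR; pose proof (pos_INR n); lra).
pose (ell := 2 * M / INR N).
assert (Hell0 : 0 < ell) by (apply Rdiv_lt_0_compat; lra).
assert (HNell : INR N * ell = 2 * M) by (unfold ell; field; lra).
assert (Hell : ell < d).
{ apply Rmult_lt_reg_l with (INR N); [lra|]; rewrite HNell.
  apply Rmult_lt_compat_r with (r := d) in HN; [|assumption].
  replace (2 * M / d * d) with (2 * M) in HN by (field; lra); lra. }
(* [box_bound] is applied twice: second derivatives below [eta] give first derivatives below
   [2 * eta * ell], and these give the oscillation of [psi]. The radius below takes 5 in place of 4
   to make the inequality strict. *)
assert (Hosc : forall x y x' y', K x y -> Rabs (x' - x) <= ell -> Rabs (y' - y) <= ell ->
  Rabs (psi x' y' - psi x y) <= 4 * eta * (ell * ell)).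
{ intros x y x' y' Hxy Hx Hy.
  replace (4 * eta * (ell * ell)) with (2 * (2 * eta * ell) * ell) by ring.
  apply (box_bound psi v x y ell); try assumption.
  intros b u w Hu Hw; split; [apply Hpsi|].
  destruct (H0 x y Hxy b) as [Hz Hpz].
  replace (v b u w) with (v b u w - v b x y) by (rewrite Hz; ring).
  apply (box_bound (v b) (fun c => pd c (v b)) x y ell); try assumption.
  intros c u' w' Hu' Hw'; split; [apply (Ck_is_pd 0), Hv|].
  assert (H := Huc b c x y u' w' ltac:(lra) ltac:(lra)).
  rewrite Hpz, Rminus_0_r in H; lra. }
pose (cell := fun (ij : nat * nat) (p : R * R) => K (fst p) (snd p) /\
  INR (fst ij) * ell <= fst p + M <= (INR (fst ij) + 1) * ell /\
  INR (snd ij) * ell <= snd p + M <= (INR (snd ij) + 1) * ell).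
(* A cell that misses [K] receives an arbitrary representative, which only adds a harmless interval
   to the covering. *)
pose (rep := fun ij => epsilon (inhabits (0, 0)) (cell ij)).
exists (map (fun ij => psi (fst (rep ij)) (snd (rep ij)))
  (list_prod (seq 0 (S N)) (seq 0 (S N)))), (5 * eta * (ell * ell)).
assert (Hl2 : 0 < eta * (ell * ell)) by (apply Rmult_lt_0_compat; [|apply Rmult_lt_0_compat]; assumption).
split; [lra|]; split.
- rewrite length_map, length_prod, length_seq, mult_INR, S_INR.
  apply Rle_trans with (5 * eta * ((2 * (INR N * ell)) * (2 * (INR N * ell)))).
  + replace (5 * eta * (ell * ell) * ((INR N + 1) * (INR N + 1)))
      with (5 * eta * (((INR N + 1) * ell) * ((INR N + 1) * ell))) by ring.
    apply Rmult_le_compat_l; [lra|].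
    apply Rmult_le_compat; nra.
  + rewrite HNell; unfold eta; right; field; lra.
- intros x y Hxy; destruct (HKM x y Hxy) as [Hx Hy].
  apply Rabs_le_between in Hx; apply Rabs_le_between in Hy.
  (* The index [N], beyond the [N] cells of the grid, is reached when [t = M]; hence
     [seq 0 (S N)]. *)
  assert (Hidx : forall t, - M <= t <= M -> exists i, In i (seq 0 (S N)) /\
    INR i * ell <= t + M <= (INR i + 1) * ell).
  { intros t Ht; destruct (nfloor_ex ((t + M) / ell)) as [i Hi].
    { apply Rmult_le_pos; [lra | apply Rlt_le, Rinv_0_lt_compat, Hell0]. }
    assert (Hi' : INR i * ell <= t + M <= (INR i + 1) * ell).
    { replace (t + M) with ((t + M) / ell * ell) by (field; lra).
      split; apply Rmult_le_compat_r; lra. }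
    exists i; split; [|assumption].
    apply in_seq; split; [lia|]; simpl.
    apply Nat.lt_succ_r, INR_le.
    apply Rmult_le_reg_r with ell; [assumption | lra]. }
  destruct (Hidx x Hx) as [i [Hi Hix]]; destruct (Hidx y Hy) as [j [Hj Hjy]].
  exists (psi (fst (rep (i, j))) (snd (rep (i, j)))); split.
  + apply in_map_iff; exists (i, j); split; [reflexivity | apply in_prod; assumption].
  + assert (Hrep : cell (i, j) (rep (i, j))).
    { apply epsilon_spec; exists (x, y); repeat split; simpl; tauto. }
    destruct Hrep as [HKr [Hrx Hry]]; simpl in Hrx, Hry.
    apply Rle_lt_trans with (4 * eta * (ell * ell)); [|lra].
    apply Hosc; [assumption | |]; apply Rabs_le_between; lra.
Qed.

(** * Averages over a window of values *)

Section WindowAverages.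
Variables psi s : R -> R -> R.
Hypothesis psi_cont : cont2 psi.
Hypothesis s_cont : cont2 s.

(** With [k = 0] this is twice the average of [g] over the window of centre [psi] and half-width
    [s], written without dividing by [s], which may vanish. Each derivative falling on [s] brings
    out a factor [z], so the weights [z ^ k] close the family under differentiation. *)
Definition moment (g : R -> R) (k : nat) (x y : R) : R :=
  RInt (fun z => z ^ k * g (psi x y + z * s x y)) (-1) 1.

Lemma moment_arg_cts (p : R * (R * R)) :
  continuous (fun q : R * (R * R) =>
    psi (fst (snd q)) (snd (snd q)) + fst q * s (fst (snd q)) (snd (snd q))) p.
Proof.
apply cts_plus; [|apply cts_mult; [apply cts_fst|]];
  (apply cts_cont2; [assumption | apply cts_fst_snd | apply cts_snd_snd]).
Qed.

Lemma moment_cont3 g k : (forall t, continuous g t) ->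
  cont3 (fun z x y => z ^ k * g (psi x y + z * s x y)).
Proof.
intros Hg p; apply cts_mult; [apply cts_pow, cts_fst|].
apply (cts_comp g); [apply moment_arg_cts | apply Hg].
Qed.

Lemma moment_ex_RInt g k x y : (forall t, continuous g t) ->
  ex_RInt (fun z => z ^ k * g (psi x y + z * s x y)) (-1) 1.
Proof.
intros Hg; apply (cont3_ex_RInt (fun z x y => z ^ k * g (psi x y + z * s x y))).
apply moment_cont3, Hg.
Qed.

Lemma moment_cont2 g k : (forall t, continuous g t) -> cont2 (moment g k).
Proof.
intros Hg; apply (cont2_RInt (fun z x y => z ^ k * g (psi x y + z * s x y))); [lra|].
apply moment_cont3, Hg.
Qed.

Lemma is_pd_moment b g g' k psib sb x y : cont2 psib -> cont2 sb ->
  (forall x y, is_pd b psi x y (psib x y)) -> (forall x y, is_pd b s x y (sb x y)) ->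
  (forall t, is_derive g t (g' t)) -> (forall t, continuous g' t) ->
  is_pd b (moment g k) x y (moment g' k x y * psib x y + moment g' (S k) x y * sb x y).
Proof.
intros Hpsib Hsb Hpsi Hs Hg Hg'.
eapply is_pd_change.
- apply (is_pd_RInt b (fun z x y => z ^ k * g (psi x y + z * s x y))
    (fun z x y => z ^ k * (g' (psi x y + z * s x y) * (psib x y + z * sb x y)))).
  + apply moment_cont3; intros t; apply is_derive_cts with (g' t), Hg.
  + intros p; apply cts_mult; [apply cts_pow, cts_fst|].
    apply cts_mult; [apply (cts_comp g'); [apply moment_arg_cts | apply Hg']|].
    apply cts_plus; [|apply cts_mult; [apply cts_fst|]];
      (apply cts_cont2; [assumption | apply cts_fst_snd | apply cts_snd_snd]).
  + intros z u w.
    eapply is_pd_change.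
    * apply is_pd_mult; [apply is_pd_const|].
      apply (is_pd_comp b g (fun x y => psi x y + z * s x y)); [apply Hg|].
      apply is_pd_plus; [apply Hpsi|].
      apply is_pd_mult; [apply is_pd_const | apply Hs].
    * simpl; ring.
- assert (E1 := moment_ex_RInt g' k x y Hg').
  assert (E2 := moment_ex_RInt g' (S k) x y Hg').
  assert (H1 := RInt_scal _ _ _ (psib x y) E1).
  assert (H2 := RInt_scal _ _ _ (sb x y) E2).
  assert (H3 := RInt_plus _ _ _ _ (ex_RInt_scal _ _ _ (psib x y) E1)
    (ex_RInt_scal _ _ _ (sb x y) E2)).
  unfold moment; rewrite (Rmult_comm _ (psib x y)), (Rmult_comm _ (sb x y)).
  etransitivity; [|etransitivity; [exact H3 | exact (f_equal2 Rplus H1 H2)]].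
  apply RInt_ext; intros z _.
  change (@eq R (z ^ k * (g' (psi x y + z * s x y) * (psib x y + z * sb x y)))
    (psib x y * (z ^ k * g' (psi x y + z * s x y)) +
     sb x y * (z ^ S k * g' (psi x y + z * s x y)))).
  simpl; ring.
Qed.

Lemma moment_Ck1 g g' k (psid sd : bool -> R -> R -> R) :
  (forall b, cont2 (psid b)) -> (forall b, cont2 (sd b)) ->
  (forall b x y, is_pd b psi x y (psid b x y)) -> (forall b x y, is_pd b s x y (sd b x y)) ->
  (forall t, is_derive g t (g' t)) -> (forall t, continuous g' t) -> Ck 1 (moment g k).
Proof.
intros Hpd Hsd Hpsi Hs Hg Hg'.
apply (Ck_intro 0 _ (fun b x y => moment g' k x y * psid b x y + moment g' (S k) x y * sd b x y)).
- intros b x y; apply is_pd_moment with (g := g); auto.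
- intros b; split; [|exact I].
  apply cont2_plus; apply cont2_mult; auto; apply moment_cont2, Hg'.
Qed.

Lemma pow_le_1 z k : -1 <= z <= 1 -> Rabs (z ^ k) <= 1.
Proof.
intros Hz; rewrite <- RPow_abs, <- (pow1 k); apply pow_incr; split; [apply Rabs_pos|].
apply Rabs_le_between; exact Hz.
Qed.

Lemma moment_bound g k B x y : (forall t, continuous g t) -> (forall t, Rabs (g t) <= B) ->
  Rabs (moment g k x y) <= 2 * B.
Proof.
intros Hg HB; replace 2 with (1 - -1) by ring.
apply abs_RInt_le_const; [lra | apply moment_ex_RInt, Hg|].
intros z Hz; rewrite Rabs_mult, <- (Rmult_1_l B).
apply Rmult_le_compat; [apply Rabs_pos.. | apply pow_le_1, Hz | apply HB].
Qed.

(* Integrating by parts in [z] trades a derivative of [g] for a factor [1 / s]. *)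
Lemma moment_derive_bound g g' k x y :
  (forall t, is_derive g t (g' t)) -> (forall t, continuous g' t) -> (forall t, Rabs (g t) <= 1) ->
  Rabs (s x y * moment g' k x y) <= 2 + 2 * INR k.
Proof.
intros Hg Hg' HB.
assert (Hgc : forall t, continuous g t) by (intros t; apply is_derive_cts with (g' t), Hg).
pose (t := fun z => psi x y + z * s x y).
assert (Hlin : forall z, is_derive t z (s x y)).
{ intros z; unfold t; auto_derive; [exact I | ring]. }
(* [p] and [q] are the two product-rule terms of the derivative of [z ^ k * g (t z)]. At [k = 0] the
   factor [INR k] makes [pred k] harmless. *)
pose (p := fun z => INR k * z ^ pred k * g (t z)).
pose (q := fun z => s x y * (z ^ k * g' (t z))).
assert (Htc : forall z, continuous t z) by (intros z; apply is_derive_cts with (s x y), Hlin).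
assert (Hpc : forall z, continuous p z).
{ intros z; apply cts_mult.
  - apply cts_mult; [apply cts_const | apply cts_pow, continuous_id].
  - apply (cts_comp g); [apply Htc | apply Hgc]. }
assert (Hqc : forall z, continuous q z).
{ intros z; apply cts_mult; [apply cts_const|]; apply cts_mult.
  - apply cts_pow, continuous_id.
  - apply (cts_comp g'); [apply Htc | apply Hg']. }
assert (Hder : forall z, is_derive (fun z => z ^ k * g (t z)) z (p z + q z)).
{ intros z.
  assert (Hpow : is_derive (fun z => z ^ k) z (INR k * z ^ pred k)).
  { auto_derive; [exact I | ring]. }
  assert (H := is_derive_mult _ _ z _ _ Hpow (is_derive_comp g t z _ _ (Hg (t z)) (Hlin z))
    Rmult_comm).
  replace (p z + q z) with (plus (mult (INR k * z ^ pred k) (g (t z)))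
    (mult (z ^ k) (scal (s x y) (g' (t z))))); [exact H|].
  unfold p, q.
  change (@eq R (INR k * z ^ pred k * g (t z) + z ^ k * (s x y * g' (t z)))
    (INR k * z ^ pred k * g (t z) + s x y * (z ^ k * g' (t z)))); ring. }
assert (Hftc : RInt p (-1) 1 + RInt q (-1) 1 = 1 ^ k * g (t 1) - (-1) ^ k * g (t (-1))).
{ apply (eq_trans (eq_sym (RInt_plus p q (-1) 1 (ex_RInt_cts p _ _ Hpc) (ex_RInt_cts q _ _ Hqc)))).
  apply (@is_RInt_unique R_CompleteNormedModule).
  apply (is_RInt_derive (fun z => z ^ k * g (t z)) (fun z => p z + q z)).
  - intros z _; apply Hder.
  - intros z _; apply cts_plus; [apply Hpc | apply Hqc]. }
assert (Hq : RInt q (-1) 1 = s x y * moment g' k x y)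
  by (exact (RInt_scal _ _ _ (s x y) (moment_ex_RInt g' k x y Hg'))).
rewrite <- Hq.
(* The integral of [p] contributes at most [2 * INR k], and the two boundary terms at most 1
   each. *)
assert (Hp : Rabs (RInt p (-1) 1) <= (1 - -1) * INR k).
{ apply abs_RInt_le_const; [lra | apply ex_RInt_cts, Hpc|].
  intros z Hz; unfold p; rewrite !Rabs_mult, (Rabs_pos_eq (INR k)) by apply pos_INR.
  pose proof (pow_le_1 z (pred k) Hz); pose proof (HB (t z)); pose proof (pos_INR k).
  pose proof (Rabs_pos (z ^ pred k)); pose proof (Rabs_pos (g (t z))).
  rewrite <- (Rmult_1_r (INR k)) at 2; rewrite Rmult_assoc; apply Rmult_le_compat_l; [assumption|].
  rewrite <- (Rmult_1_l 1); apply Rmult_le_compat; assumption. }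
assert (He : forall z, -1 <= z <= 1 -> Rabs (z ^ k * g (t z)) <= 1).
{ intros z Hz; rewrite Rabs_mult, <- (Rmult_1_l 1).
  apply Rmult_le_compat; [apply Rabs_pos.. | apply pow_le_1, Hz | apply HB]. }
assert (He1 := He 1 ltac:(lra)); assert (He2 := He (-1) ltac:(lra)).
apply Rabs_le_between in Hp; apply Rabs_le_between in He1; apply Rabs_le_between in He2.
apply Rabs_le_between; lra.
Qed.

End WindowAverages.

(** * Flattening the stream function near the compact set *)

Lemma is_derive_sec b f x y t : Ck 1 f -> is_derive (sec b f x y) t (sec b (pd b f) x y t).
Proof.
intros Hf; destruct b; [apply (Ck_is_pd 0 f true t y Hf) | apply (Ck_is_pd 0 f false x t Hf)].
Qed.

(** Some point within [r] has derivative equal to the difference quotient, hence at most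
    [2 * m / r]; returning to the original point costs at most [e * r]. With [r] fixed first, a
    small amplitude [m] then controls the gradient. *)
Lemma gradient_interpolation f b x y r m e : Ck 2 f -> 0 < r ->
  (forall x' y', Rabs (x' - x) <= r -> Rabs (y' - y) <= r ->
     Rabs (f x' y') <= m /\ Rabs (pd b (pd b f) x' y') <= e) ->
  Rabs (pd b f x y) <= 2 * m / r + e * r.
Proof.
intros Hf Hr H.
set (X := coord b x y).
assert (Hbox : forall t, X <= t <= X + r ->
  Rabs (sec b f x y t) <= m /\ Rabs (sec b (pd b (pd b f)) x y t) <= e).
{ intros t Ht; unfold X in Ht; destruct b; apply H;
    try (rewrite Rminus_diag, Rabs_R0; lra); apply Rabs_le_between; simpl in Ht; lra. }
assert (Hf1 := Ck_pred _ _ Hf); assert (Hf2 := Ck_pd _ _ b Hf).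
destruct (MVT_gen (sec b f x y) X (X + r) (sec b (pd b f) x y)) as [c [Hc Heq]].
{ intros t _; apply is_derive_sec, Hf1. }
{ intros t _; apply derivable_continuous_pt; eexists; apply is_derive_Reals, is_derive_sec, Hf1. }
rewrite Rmin_left, Rmax_right in Hc by lra.
assert (Hd : Rabs (sec b (pd b f) x y X - sec b (pd b f) x y c) <= e * Rabs (X - c)).
{ apply mvt_bound with (g := sec b (pd b (pd b f)) x y); intros t Ht; split.
  - apply is_derive_sec, Hf2.
  - apply Hbox; revert Ht; unfold Rmin, Rmax; destruct (Rle_dec c X); lra. }
unfold X in Hd at 1; rewrite sec_coord in Hd.
assert (He : 0 <= e).
{ eapply Rle_trans; [apply Rabs_pos | apply (Hbox X); lra]. }
assert (Hcr : Rabs (X - c) <= r) by (apply Rabs_le_between; lra).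
assert (Hc1 : Rabs (sec b (pd b f) x y c) <= 2 * m / r).
{ apply Rmult_le_reg_r with r; [assumption|].
  rewrite <- (Rabs_pos_eq r) at 1 by lra; rewrite <- Rabs_mult.
  replace (2 * m / r * r) with (2 * m) by (field; lra).
  replace (sec b (pd b f) x y c * r) with (sec b f x y (X + r) - sec b f x y X)
    by (rewrite Heq; ring).
  assert (H1 := proj1 (Hbox X ltac:(lra))); assert (H2 := proj1 (Hbox (X + r) ltac:(lra))).
  apply Rabs_le_between in H1; apply Rabs_le_between in H2; apply Rabs_le_between; lra. }
pose proof (Rmult_le_compat_l e _ _ He Hcr).
pose proof (Rabs_triang_inv (pd b f x y) (sec b (pd b f) x y c)); lra.
Qed.

Lemma zero_on_box_pd f c x y r :
  (forall x' y', Rabs (x' - x) < r -> Rabs (y' - y) < r -> f x' y' = 0) ->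
  forall x' y', Rabs (x' - x) < r -> Rabs (y' - y) < r -> pd c f x' y' = 0.
Proof.
intros H x' y' Hx Hy.
destruct (open2_box x y r x' y' (conj Hx Hy)) as [d [Hd Hbox]].
rewrite (pd_ext_loc c f (fun _ _ => 0) x' y' d Hd).
- apply is_pd_unique, is_pd_const.
- intros u w Hu Hw; destruct (Hbox u w Hu Hw); apply H; assumption.
Qed.

Lemma bool_common_bound (P : bool -> R -> Prop) :
  (forall b B B', B <= B' -> P b B -> P b B') ->
  (forall b, exists B, 0 < B /\ P b B) -> exists B, 0 < B /\ forall b, P b B.
Proof.
intros Hmon H; destruct (H true) as [B1 [H1 P1]]; destruct (H false) as [B2 [H2 P2]].
exists (B1 + B2); split; [lra|].
intros []; [apply (Hmon true B1) | apply (Hmon false B2)]; solve [assumption | lra].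
Qed.

Lemma triple_bound J a b r k : Rabs a <= r -> Rabs b <= r -> Rabs J * (r * r) <= k ->
  Rabs (J * a * b) <= k.
Proof.
intros Ha Hb HJ; rewrite !Rabs_mult.
pose proof (Rabs_pos a); pose proof (Rabs_pos b); pose proof (Rabs_pos J).
apply Rle_trans with (2 := HJ); rewrite Rmult_assoc; apply Rmult_le_compat_l; [assumption|].
apply Rmult_le_compat; assumption.
Qed.

Lemma double_bound J a k l : Rabs J <= k -> Rabs a <= l -> Rabs (J * a) <= k * l.
Proof.
intros HJ Ha; rewrite Rabs_mult; apply Rmult_le_compat; auto using Rabs_pos.
Qed.

(** The algebra of a second derivative of the window average: [J0], [J1], [J2] are moments of [g'],
    [I0] and [I1] moments of [g], and [r] stands for [|grad psi|]. Four terms of size [6 / A] and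
    two of size [2 * e], halved, give the bound. Weighting the [J] by [A * (r * r)] avoids a
    division where the gradient vanishes. *)
Lemma hessian_bound A r e J0 J1 J2 I0 I1 pb pc sb sc pbc sbc :
  0 < A -> Rabs pb <= r -> Rabs pc <= r -> Rabs sb <= r -> Rabs sc <= r ->
  Rabs (A * (r * r) * J0) <= 6 -> Rabs (A * (r * r) * J1) <= 6 -> Rabs (A * (r * r) * J2) <= 6 ->
  Rabs I0 <= 2 -> Rabs I1 <= 2 -> Rabs pbc <= e -> Rabs sbc <= e ->
  Rabs (/ 2 * ((J0 * pb + J1 * sb) * pc + I0 * pbc + ((J1 * pb + J2 * sb) * sc + I1 * sbc)))
    <= 12 / A + 2 * e.
Proof.
intros HA Hpb Hpc Hsb Hsc H0 H1 H2 HI0 HI1 Hpbc Hsbc.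
assert (HJ : forall J, Rabs (A * (r * r) * J) <= 6 -> Rabs J * (r * r) <= 6 / A).
{ intros J HJ; rewrite Rabs_mult, (Rabs_pos_eq (A * (r * r))) in HJ by nra.
  apply Rmult_le_reg_l with A; [assumption|].
  replace (A * (6 / A)) with 6 by (field; lra); lra. }
assert (T1 := triple_bound J0 pb pc r _ Hpb Hpc (HJ _ H0)).
assert (T2 := triple_bound J1 sb pc r _ Hsb Hpc (HJ _ H1)).
assert (T3 := triple_bound J1 pb sc r _ Hpb Hsc (HJ _ H1)).
assert (T4 := triple_bound J2 sb sc r _ Hsb Hsc (HJ _ H2)).
assert (T5 := double_bound I0 pbc _ _ HI0 Hpbc).
assert (T6 := double_bound I1 sbc _ _ HI1 Hsbc).
replace (12 / A) with (2 * (6 / A)) by (field; lra).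
apply Rabs_le_between in T1; apply Rabs_le_between in T2; apply Rabs_le_between in T3.
apply Rabs_le_between in T4; apply Rabs_le_between in T5; apply Rabs_le_between in T6.
apply Rabs_le_between; lra.
Qed.

(** The Leibniz terms of a second derivative of cutoff times average: [B] bounds the derivatives of
    the cutoff, and [m], [k], [l] bound the average and its first and second derivatives. *)
Lemma product_hessian_bound a b c d e a' b' c' d' B m k l :
  Rabs a <= B -> Rabs a' <= m -> Rabs b <= B -> Rabs b' <= k ->
  Rabs c <= B -> Rabs c' <= k -> Rabs d <= 1 -> Rabs d' <= l ->
  B * m + 2 * (B * k) + l <= e ->
  Rabs (a * a' + b * b' + (c * c' + d * d')) <= e.
Proof.
intros Ha Ha' Hb Hb' Hc Hc' Hd Hd' He.
assert (T1 := double_bound _ _ _ _ Ha Ha'); assert (T2 := double_bound _ _ _ _ Hb Hb').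
assert (T3 := double_bound _ _ _ _ Hc Hc'); assert (T4 := double_bound _ _ _ _ Hd Hd').
apply Rabs_le_between in T1; apply Rabs_le_between in T2; apply Rabs_le_between in T3.
apply Rabs_le_between in T4; apply Rabs_le_between; lra.
Qed.

Section Flattening.
Variables (psi : R -> R -> R) (v : bool -> R -> R -> R) (A : R) (h g g' : R -> R).
Hypothesis v_Ck : forall b, Ck 2 (v b).
Hypothesis psi_pd : forall b x y, is_pd b psi x y (v b x y).
Hypothesis A_gt0 : 0 < A.
Hypothesis h_derive : forall t, is_derive h t (g t).
Hypothesis g_derive : forall t, is_derive g t (g' t).
Hypothesis g'_cts : forall t, continuous g' t.
Hypothesis g_le1 : forall t, Rabs (g t) <= 1.

(* The averaging width is quadratic in the velocity: this makes [|grad psi|^2 / width] equal to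
   [1 / A], and the width is of class C^2 with small second derivatives near [K]. *)
Definition width (x y : R) : R :=
  A * (v true x y * v true x y + v false x y * v false x y).

Definition width_pd (b : bool) (x y : R) : R :=
  2 * A * (v true x y * pd b (v true) x y + v false x y * pd b (v false) x y).

Definition width_pd2 (b c : bool) (x y : R) : R :=
  2 * A * ((pd b (v true) x y * pd c (v true) x y + v true x y * pd b (pd c (v true)) x y) +
           (pd b (v false) x y * pd c (v false) x y + v false x y * pd b (pd c (v false)) x y)).

Definition smoothed (x y : R) : R := / 2 * moment psi width h 0 x y.

Definition smoothed_pd (c : bool) (x y : R) : R :=
  / 2 * (moment psi width g 0 x y * v c x y + moment psi width g 1 x y * width_pd c x y).

Definition smoothed_pd2 (b c : bool) (x y : R) : R :=
  / 2 * ((moment psi width g' 0 x y * v b x y + moment psi width g' 1 x y * width_pd b x y) * v c x y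
         + moment psi width g 0 x y * pd b (v c) x y
         + ((moment psi width g' 1 x y * v b x y + moment psi width g' 2 x y * width_pd b x y)
              * width_pd c x y
            + moment psi width g 1 x y * width_pd2 b c x y)).

Lemma is_pd_width b x y : is_pd b width x y (width_pd b x y).
Proof.
assert (Hv : forall c, is_pd b (v c) x y (pd b (v c) x y)) by (intros c; apply (Ck_is_pd 1), v_Ck).
eapply is_pd_change.
- apply is_pd_mult; [apply is_pd_const|].
  apply is_pd_plus; apply is_pd_mult; apply Hv.
- unfold width_pd; simpl; ring.
Qed.

Lemma is_pd_width_pd b c x y : is_pd b (width_pd c) x y (width_pd2 b c x y).
Proof.
assert (Hv : forall a, is_pd b (v a) x y (pd b (v a) x y)) by (intros a; apply (Ck_is_pd 1), v_Ck).
assert (Hv' : forall a, is_pd b (pd c (v a)) x y (pd b (pd c (v a)) x y))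
  by (intros a; apply (Ck_is_pd 0), Ck_pd, v_Ck).
eapply is_pd_change.
- apply is_pd_mult; [apply is_pd_const|].
  apply is_pd_plus; (apply is_pd_mult; [apply Hv | apply Hv']).
- unfold width_pd2; simpl; ring.
Qed.

Lemma width_pd_Ck c : Ck 1 (width_pd c).
Proof.
apply Ck_scal; apply Ck_plus; apply Ck_mult; try (apply Ck_pred, v_Ck); apply Ck_pd, v_Ck.
Qed.

Lemma v_cont c : cont2 (v c).
Proof. apply (Ck_cont 2), v_Ck. Qed.

Lemma width_cont : cont2 width.
Proof.
apply cont2_mult; [apply cont2_const|].
apply cont2_plus; apply cont2_mult; apply v_cont.
Qed.

Lemma width_pd_cont c : cont2 (width_pd c).
Proof. apply (Ck_cont 1), width_pd_Ck. Qed.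

Lemma psi_cont2 : cont2 psi.
Proof. apply (is_pd_cont2 psi v psi_pd), v_cont. Qed.

Lemma g_cts t : continuous g t.
Proof. apply is_derive_cts with (g' t), g_derive. Qed.

Lemma is_pd_smoothed c x y : is_pd c smoothed x y (smoothed_pd c x y).
Proof.
eapply is_pd_change.
- apply is_pd_mult; [apply is_pd_const|].
  apply (is_pd_moment psi width psi_cont2 width_cont c h g 0 (v c) (width_pd c)).
  + apply v_cont.
  + apply width_pd_cont.
  + intros; apply psi_pd.
  + intros; apply is_pd_width.
  + assumption.
  + apply g_cts.
- unfold smoothed_pd; simpl; ring.
Qed.

Lemma is_pd_smoothed_pd b c x y : is_pd b (smoothed_pd c) x y (smoothed_pd2 b c x y).
Proof.
assert (Hm : forall k, is_pd b (moment psi width g k) x y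
  (moment psi width g' k x y * v b x y + moment psi width g' (S k) x y * width_pd b x y)).
{ intros k; apply (is_pd_moment psi width psi_cont2 width_cont b g g' k (v b) (width_pd b));
    auto using v_cont, width_pd_cont, is_pd_width. }
eapply is_pd_change.
- apply is_pd_mult; [apply is_pd_const|].
  apply is_pd_plus; (apply is_pd_mult; [apply Hm|]).
  + apply (Ck_is_pd 1), v_Ck.
  + apply is_pd_width_pd.
- unfold smoothed_pd2; simpl; ring.
Qed.

Lemma smoothed_Ck : Ck 2 smoothed.
Proof.
assert (Hm : forall k, Ck 1 (moment psi width g k)).
{ intros k; apply (moment_Ck1 psi width psi_cont2 width_cont g g' k v width_pd);
    auto using v_cont, width_pd_cont, is_pd_width. }
apply (Ck_intro 1 _ smoothed_pd); [intros; apply is_pd_smoothed|].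
intros c; apply Ck_scal, Ck_plus; (apply Ck_mult; [apply Hm|]); [|apply width_pd_Ck].
apply Ck_pred, v_Ck.
Qed.

Lemma smoothed_bound m x y : (forall t, Rabs (h t) <= m) -> Rabs (smoothed x y) <= m.
Proof.
intros Hm; unfold smoothed; rewrite Rabs_mult, (Rabs_pos_eq (/ 2)) by lra.
assert (H := moment_bound psi width psi_cont2 width_cont h 0 m x y
  (fun t => is_derive_cts _ _ _ (h_derive t)) Hm); lra.
Qed.

(** The condition [4 * A * tau <= 1] makes the gradient of the width at most [r = |grad psi|]. Every
    product of first derivatives is then at most [r * r], and [A * (r * r)] is exactly the width
    that integration by parts asks for. *)
Lemma smoothed_pd2_bound tau B x y b c :
  0 < tau -> 4 * A * tau <= 1 ->
  (forall a, Rabs (v a x y) <= tau) -> (forall a c, Rabs (pd c (v a) x y) <= tau) ->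
  (forall a b c, Rabs (pd b (pd c (v a)) x y) <= B) ->
  Rabs (smoothed_pd2 b c x y) <= 12 / A + 2 * (tau + 4 * A * tau * (tau + B)).
Proof.
intros Htau HAtau Hv Hvd Hvdd.
set (q := v true x y * v true x y + v false x y * v false x y).
assert (Hq : 0 <= q) by (unfold q; nra).
assert (HB : 0 <= B) by (eapply Rle_trans; [apply Rabs_pos | apply (Hvdd true true true)]).
pose (r := sqrt q).
assert (Hrr : r * r = q) by (apply sqrt_sqrt, Hq).
assert (Hr : 0 <= r) by apply sqrt_pos.
assert (Hvr : forall a, Rabs (v a x y) <= r).
{ intros a; rewrite <- sqrt_Rsqr_abs; apply sqrt_le_1_alt; unfold Rsqr, q; destruct a; nra. }
assert (Hw : width x y = A * (r * r)) by (rewrite Hrr; reflexivity).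
assert (Hwd : forall a, Rabs (width_pd a x y) <= r).
{ intros a; unfold width_pd.
  assert (T1 := double_bound _ _ _ _ (Hvr true) (Hvd true a)).
  assert (T2 := double_bound _ _ _ _ (Hvr false) (Hvd false a)).
  apply Rle_trans with (2 * A * (r * tau + r * tau)); [|nra].
  rewrite Rabs_mult, (Rabs_pos_eq (2 * A)) by lra.
  apply Rmult_le_compat_l; [lra|].
  apply Rle_trans with (1 := Rabs_triang _ _); lra. }
assert (HAB : 0 <= 4 * A * tau * (tau + B)) by (repeat apply Rmult_le_pos; lra).
assert (Hm : forall k, (k <= 2)%nat -> Rabs (A * (r * r) * moment psi width g' k x y) <= 6).
{ intros k Hk; rewrite <- Hw.
  eapply Rle_trans; [apply (moment_derive_bound psi width psi_cont2 width_cont g g'); assumption|].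
  apply le_INR in Hk; simpl in Hk; lra. }
assert (HI : forall k, Rabs (moment psi width g k x y) <= 2).
{ intros k; replace 2 with (2 * 1) by ring.
  apply moment_bound; auto using psi_cont2, width_cont, g_cts. }
unfold smoothed_pd2; apply hessian_bound with (r := r); auto.
- apply Rle_trans with tau; [apply Hvd | lra].
- unfold width_pd2.
  assert (T1 := double_bound _ _ _ _ (Hvd true b) (Hvd true c)).
  assert (T2 := double_bound _ _ _ _ (Hv true) (Hvdd true b c)).
  assert (T3 := double_bound _ _ _ _ (Hvd false b) (Hvd false c)).
  assert (T4 := double_bound _ _ _ _ (Hv false) (Hvdd false b c)).
  apply Rle_trans with (2 * A * (2 * (tau * tau + tau * B))); [|nra].
  rewrite Rabs_mult, (Rabs_pos_eq (2 * A)) by lra.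
  apply Rmult_le_compat_l; [lra|].
  apply Rabs_le_between in T1; apply Rabs_le_between in T2.
  apply Rabs_le_between in T3; apply Rabs_le_between in T4.
  apply Rabs_le_between; lra.
Qed.

(* Where [h] has slope 1 on the whole averaging window, the average of [h] is [h] itself, hence
   [psi] up to a constant. *)
Lemma smoothed_affine c l x y : (forall t, Rabs (t - c) <= l -> g t = 1) ->
  Rabs (psi x y - c) + Rabs (width x y) <= l -> smoothed x y = psi x y + (h c - c).
Proof.
intros Hg Hl.
assert (Hh : forall t, Rabs (t - c) <= l -> h t = t + (h c - c)).
{ intros t Ht.
  assert (H := mvt_bound (fun t => h t - t) (fun t => g t - 1) c t 0).
  cut (Rabs (h t - t - (h c - c)) <= 0 * Rabs (t - c)).
  { rewrite Rmult_0_l; intros H'; pose proof (Rabs_pos (h t - t - (h c - c))).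
    assert (Hz : Rabs (h t - t - (h c - c)) = 0) by lra.
    apply Rabs_eq_0 in Hz; lra. }
  apply H; intros u Hu; split.
  - apply (is_derive_minus h (fun t => t) u (g u) 1); [apply h_derive | apply (is_derive_id u)].
  - rewrite Hg; [rewrite Rminus_diag, Rabs_R0; lra|].
    apply (Rabs_between u c t); [assumption | | assumption].
    rewrite Rminus_diag, Rabs_R0; apply Rle_trans with (2 := Ht), Rabs_pos. }
set (a := psi x y + (h c - c)); set (s := width x y) in *.
assert (Hint : RInt (fun z => z ^ 0 * h (psi x y + z * s)) (-1) 1 = 2 * a).
{ apply (@is_RInt_unique R_CompleteNormedModule).
  apply (is_RInt_ext (fun z => a + z * s)).
  - intros z Hz; rewrite Rmin_left, Rmax_right in Hz by lra.
    change (@eq R (a + z * s) (z ^ 0 * h (psi x y + z * s))).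
    rewrite Hh; [unfold a; simpl; ring|].
    replace (psi x y + z * s - c) with ((psi x y - c) + z * s) by ring.
    apply Rle_trans with (1 := Rabs_triang _ _), Rle_trans with (2 := Hl).
    apply Rplus_le_compat_l; rewrite Rabs_mult; rewrite <- (Rmult_1_l (Rabs s)) at 2.
    apply Rmult_le_compat_r; [apply Rabs_pos | apply Rabs_le_between; lra].
  - replace (2 * a) with (minus (a * 1 + 1 ^ 2 / 2 * s) (a * -1 + (-1) ^ 2 / 2 * s))
      by (unfold minus, plus, opp; simpl; field).
    apply (is_RInt_derive (fun z => a * z + z ^ 2 / 2 * s) (fun z => a + z * s)).
    + intros z _; auto_derive; [exact I | simpl; field].
    + intros z _; apply cts_plus; [apply cts_const|].
      apply cts_mult; [apply continuous_id | apply cts_const]. }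
unfold smoothed, moment; fold s.
replace a with (/ 2 * (2 * a)) by field; f_equal; exact Hint.
Qed.

End Flattening.

(** * Choice of constants and the flattening potential *)

Lemma small_gradient_open (v : bool -> R -> R -> R) tau : (forall b, Ck 1 (v b)) ->
  open2 (fun x y => forall b, Rabs (v b x y) < tau /\ forall c, Rabs (pd c (v b) x y) < tau).
Proof.
intros Hv x y H.
assert (Hopen : forall f, cont2 f -> Rabs (f x y) < tau -> exists d, 0 < d /\
  forall x' y', Rabs (x' - x) < d -> Rabs (y' - y) < d -> Rabs (f x' y') < tau).
{ intros f Hf Hlt; destruct (Hf x y (tau - Rabs (f x y))) as [d [Hd H']]; [lra|].
  exists d; split; [assumption|]; intros x' y' Hx Hy; specialize (H' x' y' Hx Hy).
  pose proof (Rabs_triang_inv (f x' y') (f x y)); lra. }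
destruct (bool2_common_radius (fun b c d => forall x' y', Rabs (x' - x) < d -> Rabs (y' - y) < d ->
  Rabs (v b x' y') < tau /\ Rabs (pd c (v b) x' y') < tau)) as [d [Hd Hall]].
- intros b c d d' Hdd' Hd x' y' Hx Hy; apply Hd; lra.
- intros b c; destruct (H b) as [H1 H2].
  destruct (Hopen (v b) (Ck_cont 1 _ (Hv b)) H1) as [d1 [Hd1 P1]].
  destruct (Hopen (pd c (v b)) (Ck_cont 0 _ (Ck_pd 0 _ c (Hv b))) (H2 c)) as [d2 [Hd2 P2]].
  exists (Rmin d1 d2); split; [apply Rmin_pos; assumption|].
  pose proof (Rmin_l d1 d2); pose proof (Rmin_r d1 d2).
  intros x' y' Hx Hy; split; [apply P1 | apply P2]; lra.
- exists d; split; [assumption|]; intros x' y' Hx Hy b; split; [apply (Hall b true x' y' Hx Hy)|].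
  intros c; apply (Hall b c x' y' Hx Hy).
Qed.

(** Each constant depends only on earlier ones: [A] on [eps], [tau] on [A] and the second
    derivatives of [v], the cutoff [chi] on [tau], the interpolation radius [r] on [chi], the
    amplitude [m] on [r] and [chi]. Only then come the covering of [psi(K)] and [h], whose steepness
    enters no constant. *)
Lemma flattening_exists K psi (v : bool -> R -> R -> R) eps :
  compact2 K -> (forall b, Ck 2 (v b)) -> (forall b, compact_supp (v b)) ->
  (forall b x y, is_pd b psi x y (v b x y)) ->
  (forall x y, K x y -> forall b, v b x y = 0 /\ forall c, pd c (v b) x y = 0) ->
  0 < eps ->
  exists V, Ck 2 V /\ compact_supp V /\
    (forall b x y, Rabs (pd b V x y) <= eps) /\
    (forall b c x y, Rabs (pd b (pd c V) x y) <= eps) /\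
    (forall x y, K x y -> exists d k, 0 < d /\ forall x' y', Rabs (x' - x) < d ->
       Rabs (y' - y) < d -> V x' y' = psi x' y' + k).
Proof.
intros HK Hv Hsupp Hpsi H0 Heps.
destruct (bool_common_bound (fun a B => forall b c x y, Rabs (pd b (pd c (v a)) x y) <= B))
  as [B2 [HB2 Hvdd]].
{ intros a B B' HBB' H b c x y; eapply Rle_trans; [apply H | assumption]. }
{ intros a.
  apply (bool_common_bound (fun b B => forall c x y, Rabs (pd b (pd c (v a)) x y) <= B)).
  { intros b B B' HBB' H c x y; eapply Rle_trans; [apply H | assumption]. }
  intros b.
  apply (bool_common_bound (fun c B => forall x y, Rabs (pd b (pd c (v a)) x y) <= B)).
  { intros c B B' HBB' H x y; eapply Rle_trans; [apply H | assumption]. }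
  intros c; apply compact_supp_bounded.
  - apply (Ck_cont 0), Ck_pd, Ck_pd, Hv.
  - apply compact_supp_pd, compact_supp_pd, Hsupp. }
pose (e := eps / 4); assert (He : 0 < e) by (unfold e; lra).
(* With this value [12 / A = e / 2], half of the Hessian budget [e]. *)
pose (A := 24 / e); assert (HA : 0 < A) by (apply Rdiv_lt_0_compat; lra).
(* From [D * tau <= e], the term 96 gives [96 * A * tau <= A * e = 24], that is [4 * A * tau <= 1],
   while the remaining term keeps the rest of the Hessian bound below [e / 2]. *)
pose (D := 96 + 32 * A * (1 + B2)).
assert (HAB : 0 < A * (1 + B2)) by (apply Rmult_lt_0_compat; lra).
assert (HD : 0 < D) by (unfold D; lra).
pose (tau := Rmin 1 (e / D)).
assert (HeD : 0 < e / D) by (apply Rdiv_lt_0_compat; lra).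
assert (Htau : 0 < tau) by (apply Rmin_pos; lra).
assert (Htau1 : tau <= 1) by apply Rmin_l.
assert (HtauD : D * tau <= e).
{ apply Rle_trans with (D * (e / D)); [apply Rmult_le_compat_l; [lra | apply Rmin_r]|].
  right; field; lra. }
assert (HAe : A * e = 24) by (unfold A; field; lra).
assert (HAtau : 4 * A * tau <= 1).
{ assert (A * (D * tau) <= 24) by (rewrite <- HAe; apply Rmult_le_compat_l; lra).
  assert (0 < A * tau) by (apply Rmult_lt_0_compat; assumption).
  assert (96 * (A * tau) <= A * (D * tau)) by (unfold D; nra).
  lra. }
assert (Hsmall : 12 / A + 2 * (tau + 4 * A * tau * (tau + B2)) <= e).
{ assert (12 / A = e / 2) by (unfold A; field; lra).
  assert (A * tau * (tau + B2) <= A * tau * (1 + B2)).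
  { apply Rmult_le_compat_l; [apply Rlt_le, Rmult_lt_0_compat; assumption | lra]. }
  unfold D in HtauD; nra. }
pose (U := fun x y => forall b, Rabs (v b x y) < tau /\ forall c, Rabs (pd c (v b) x y) < tau).
destruct (cutoff_exists K U HK) as [chi [r0 [Hr0 [Hchi [Hchis [Hchi01 [Hchi1 Hdich]]]]]]].
{ apply small_gradient_open; intros b; apply Ck_pred, Hv. }
{ intros x y Hxy b; destruct (H0 x y Hxy b) as [H1 H2]; split; [|intros c; rewrite H2];
    [rewrite H1|]; rewrite Rabs_R0; assumption. }
destruct (bool_common_bound (fun b B => forall x y, Rabs (pd b chi x y) <= B)) as [B3 [HB3 Hchid]].
{ intros b B B' HBB' H x y; eapply Rle_trans; [apply H | assumption]. }
{ intros b; apply compact_supp_bounded; [|apply compact_supp_pd, Hchis].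
  apply (Ck_cont 1), Ck_pd, Hchi. }
destruct (bool_common_bound (fun b B => forall c x y, Rabs (pd b (pd c chi) x y) <= B))
  as [B4 [HB4 Hchidd]].
{ intros b B B' HBB' H c x y; eapply Rle_trans; [apply H | assumption]. }
{ intros b; apply (bool_common_bound (fun c B => forall x y, Rabs (pd b (pd c chi) x y) <= B)).
  { intros c B B' HBB' H x y; eapply Rle_trans; [apply H | assumption]. }
  intros c; apply compact_supp_bounded; [|apply compact_supp_pd, compact_supp_pd, Hchis].
  apply (Ck_cont 0), Ck_pd, Ck_pd, Hchi. }
pose (B := 1 + B3 + B4); assert (HB : 1 <= B) by (unfold B; lra).
assert (HiB : 0 < / (2 * B)) by (apply Rinv_0_lt_compat; lra).
(* [r0] keeps the interpolation box inside [U]; [/ (2 * B)] makes the [e * r] part of the gradient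
   bound cost at most [e] after multiplication by [2 * B]. *)
pose (r := Rmin r0 (/ (2 * B))); assert (Hr : 0 < r) by (apply Rmin_pos; assumption).
assert (Hrr0 : r <= r0) by apply Rmin_l.
assert (HrB : 2 * B * r <= 1).
{ apply Rle_trans with (2 * B * / (2 * B)); [apply Rmult_le_compat_l; [lra | apply Rmin_r]|].
  right; field; lra. }
(* The solution of [B * m + 4 * B * m / r = e], which collects all terms of the final Hessian bound
   that contain the amplitude. *)
pose (m := e * r / (B * (r + 4))).
assert (Hm : 0 < m).
{ apply Rdiv_lt_0_compat; apply Rmult_lt_0_compat; lra. }
assert (Hmr : B * m + 4 * (B * (m / r)) = e) by (unfold m; field; repeat split; lra).
assert (Hmr0 : 0 < m / r) by (apply Rdiv_lt_0_compat; assumption).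
(* The staircase has amplitude four times the sum of the radii; hence [m / 4]. *)
destruct (critical_values_null K psi v HK (fun b => Ck_pred _ _ (Hv b)) Hsupp Hpsi H0 (m / 4))
  as [cs [l [Hl [Hlen Hcs]]]]; [lra|].
destruct (staircase_exists cs l Hl) as [h [g [g' [Hh [Hg [Hg' [Hg1 [Hhb Hgone]]]]]]]].
pose (Phi := smoothed psi v A h).
assert (HPhi : Ck 2 Phi) by (apply (smoothed_Ck psi v A h g g'); assumption).
assert (HPhim : forall x y, Rabs (Phi x y) <= m).
{ intros x y; apply (smoothed_bound psi v A h g); try assumption.
  intros t; eapply Rle_trans; [apply Hhb|]; lra. }
assert (HPhid : forall c, pd c Phi = smoothed_pd psi v A g c).
{ intros c; apply is_pd_eq; intros x y; apply (is_pd_smoothed psi v A h g g'); assumption. }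
assert (HPhidd : forall b c x y, U x y -> Rabs (pd b (pd c Phi) x y) <= e).
{ intros b c x y HU; rewrite HPhid.
  rewrite (is_pd_unique _ _ _ _ _ (is_pd_smoothed_pd psi v A g g' Hv Hpsi Hg Hg' b c x y)).
  apply Rle_trans with (2 := Hsmall); apply smoothed_pd2_bound with (g := g); try assumption.
  - intros a; apply Rlt_le, HU.
  - intros a c'; apply Rlt_le, HU.
  - intros a b' c'; apply Hvdd. }
pose (kappa := 2 * m / r + e * r).
assert (Hkappa : 0 <= kappa).
{ unfold kappa; pose proof (Rmult_lt_0_compat e r He Hr).
  replace (2 * m / r) with (2 * (m / r)) by (field; lra); lra. }
assert (HBk : B * m + 2 * (B * kappa) + e <= eps).
{ replace (2 * (B * kappa)) with (4 * (B * (m / r)) + (2 * B * r) * e)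
    by (unfold kappa; field; lra).
  assert ((2 * B * r) * e <= 1 * e) by (apply Rmult_le_compat_r; lra).
  unfold e in *; lra. }
pose (V := fun x y => chi x y * Phi x y).
assert (HVd : forall c, pd c V = fun x y => pd c chi x y * Phi x y + chi x y * pd c Phi x y).
{ intros c; apply (pd_mult 1); assumption. }
assert (HVdd : forall b c x y, pd b (pd c V) x y =
  pd b (pd c chi) x y * Phi x y + pd c chi x y * pd b Phi x y +
  (pd b chi x y * pd c Phi x y + chi x y * pd b (pd c Phi) x y)).
{ intros b c x y; rewrite HVd; apply is_pd_unique.
  apply is_pd_plus; apply is_pd_mult; solve
    [ apply (Ck_is_pd 0), Ck_pd; assumption | apply (Ck_is_pd 1); assumption ]. }
(* Either the bounds on [Phi] hold on a box around the point and interpolation controls its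
   gradient, or [chi] vanishes on a box and [V] with it. *)
assert (Hcase : forall x y,
  (U x y /\ forall c, Rabs (pd c Phi x y) <= kappa) \/
  ((forall c, pd c V x y = 0) /\ forall b c, pd b (pd c V) x y = 0)).
{ intros x y; destruct (Hdich x y) as [HU | Hz]; [left | right].
  - split; [apply HU; rewrite Rminus_diag, Rabs_R0; lra|].
    intros c; apply gradient_interpolation; try assumption.
    intros x' y' Hx Hy; split; [apply HPhim | apply HPhidd, HU; lra].
  - assert (HVz : forall x' y', Rabs (x' - x) < r0 -> Rabs (y' - y) < r0 -> V x' y' = 0).
    { intros x' y' Hx Hy; unfold V; rewrite Hz by assumption; ring. }
    assert (Hxx : Rabs (x - x) < r0) by (rewrite Rminus_diag, Rabs_R0; assumption).
    assert (Hyy : Rabs (y - y) < r0) by (rewrite Rminus_diag, Rabs_R0; assumption).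
    split.
    + intros c; apply (zero_on_box_pd V c x y r0 HVz); assumption.
    + intros b c; apply (zero_on_box_pd (pd c V) b x y r0); try assumption.
      apply zero_on_box_pd; assumption. }
assert (Hchia : forall x y, Rabs (chi x y) <= 1).
{ intros x y; rewrite Rabs_pos_eq; apply Hchi01. }
exists V; split; [apply Ck_mult; assumption|]; split; [apply compact_supp_mult, Hchis|].
split; [|split].
- intros b x y; destruct (Hcase x y) as [[HU Hk] | [Hz _]].
  + rewrite HVd.
    assert (T1 := double_bound _ _ _ _ (Hchid b x y) (HPhim x y)).
    assert (T2 := double_bound _ _ _ _ (Hchia x y) (Hk b)).
    apply Rle_trans with (1 := Rabs_triang _ _).
    assert (B3 * m <= B * m) by (apply Rmult_le_compat_r; unfold B; lra).
    assert (1 * kappa <= B * kappa) by (apply Rmult_le_compat_r; lra).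
    lra.
  + rewrite Hz, Rabs_R0; lra.
- intros b c x y; destruct (Hcase x y) as [[HU Hk] | [_ Hz]].
  + rewrite HVdd; apply product_hessian_bound with (B := B) (m := m) (k := kappa) (l := e); auto.
    * eapply Rle_trans; [apply Hchidd | unfold B; lra].
    * eapply Rle_trans; [apply Hchid | unfold B; lra].
    * eapply Rle_trans; [apply Hchid | unfold B; lra].
  + rewrite Hz, Rabs_R0; lra.
- intros x y Hxy.
  destruct (Hcs x y Hxy) as [c [Hc Hclose]].
  destruct (Hchi1 x y Hxy) as [d1 [Hd1 Hone]].
  (* The distance of [psi x y] from the edge of its plateau is shared equally between the variation
     of [psi] and the width, which vanishes at points of [K]. *)
  pose (zeta := (l - Rabs (psi x y - c)) / 2); assert (Hzeta : 0 < zeta) by (unfold zeta; lra).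
  destruct (psi_cont2 psi v Hv Hpsi x y zeta Hzeta) as [d2 [Hd2 Hpsi2]].
  destruct (width_cont v A Hv x y zeta Hzeta) as [d3 [Hd3 Hw3]].
  assert (Hw0 : width v A x y = 0).
  { unfold width; rewrite (proj1 (H0 x y Hxy true)), (proj1 (H0 x y Hxy false)); ring. }
  pose proof (Rmin_l d1 (Rmin d2 d3)); pose proof (Rmin_r d1 (Rmin d2 d3)).
  pose proof (Rmin_l d2 d3); pose proof (Rmin_r d2 d3).
  exists (Rmin d1 (Rmin d2 d3)), (h c - c); split; [repeat apply Rmin_pos; assumption|].
  intros x' y' Hx Hy; unfold V; rewrite Hone by lra; rewrite Rmult_1_l.
  apply (smoothed_affine psi v A h g Hh c l); [intros t; apply Hgone, Hc|].
  specialize (Hpsi2 x' y' ltac:(lra) ltac:(lra)).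
  specialize (Hw3 x' y' ltac:(lra) ltac:(lra)); rewrite Hw0, Rminus_0_r in Hw3.
  pose proof (Rabs_diff_triang (psi x' y') (psi x y) c); unfold zeta in *; lra.
Qed.

(** * Approximation *)

(** Integrate [u1] upwards from a horizontal line that avoids the support of [u2]. Zero divergence
    turns the x-derivative into the integral of [- dy u2], whose boundary term on that line
    vanishes. *)
Lemma stream_function_exists u1 u2 : Ck 1 u1 -> Ck 1 u2 -> compact_supp u2 ->
  (forall x y, div2 u1 u2 x y = 0) ->
  exists psi, forall b x y, is_pd b psi x y (if b then - u2 x y else u1 x y).
Proof.
intros Hu1 Hu2 [M HM] Hdiv.
pose (L := - (Rabs M + 1)).
assert (HL : forall x, u2 x L = 0).
{ intros x; apply HM; right; unfold L; rewrite Rabs_Ropp, Rabs_pos_eq.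
  - pose proof (Rle_abs M); lra.
  - pose proof (Rabs_pos M); lra. }
assert (Hc : forall (f : R -> R -> R) x t, cont2 f -> continuous (fun z => f x z) t).
{ intros f x t Hf; apply (cts_cont2 f (fun _ => x) (fun z => z) t Hf);
    [apply cts_const | apply continuous_id]. }
assert (Hc3 : forall f, cont2 f -> cont3 (fun z x y => f x z)).
{ intros f Hf p; apply (cts_cont2 f); [assumption | apply cts_fst_snd | apply cts_fst]. }
exists (fun x y => RInt (fun t => u1 x t) L y); intros [] x y.
- assert (H := is_pd_RInt true (fun z x y => u1 x z) (fun z x y => dx u1 x z) L y x y
    (Hc3 _ (Ck_cont 1 _ Hu1)) (Hc3 _ (Ck_cont 0 _ (Ck_pd 0 _ true Hu1)))
    (fun z x' y' => Ck_is_pd 0 u1 true x' z Hu1)).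
  replace (- u2 x y) with (RInt (fun z => dx u1 x z) L y); [exact H|].
  rewrite (RInt_ext _ (fun z => - dy u2 x z)).
  + apply (@is_RInt_unique R_CompleteNormedModule).
    replace (- u2 x y) with (minus (- u2 x y) (- u2 x L))
      by (rewrite HL; unfold minus, plus, opp; simpl; ring).
    apply (is_RInt_derive (fun z => - u2 x z) (fun z => - dy u2 x z)).
    * intros z _; apply (is_derive_opp (fun z => u2 x z)), (Ck_is_pd 0 u2 false x z Hu2).
    * intros z _; apply cts_opp, (Hc (dy u2)), (Ck_cont 0), (Ck_pd 0 _ false Hu2).
  + intros z _; specialize (Hdiv x z); unfold div2 in Hdiv.
    change (dx u1 x z = - dy u2 x z :> R); lra.
- apply (is_derive_primitive (fun t => u1 x t)); intros t; apply Hc, (Ck_cont 1), Hu1.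
Qed.

(** The points near which [f] vanishes form an open set containing [K], so a Lebesgue number gives
    the uniform distance that mollification at a fixed scale requires. *)
Lemma supp_disjoint_uniform K f : compact2 K -> supp_disjoint f K ->
  exists d, 0 < d /\ forall x y x' y', K x y ->
    Rabs (x' - x) <= d -> Rabs (y' - y) <= d -> f x' y' = 0.
Proof.
intros HK Hf.
pose (U := fun x y => exists d, 0 < d /\
  forall x' y', Rabs (x' - x) < d -> Rabs (y' - y) < d -> f x' y' = 0).
destruct (compact2_lebesgue K U HK) as [d [Hd H]]; [|exact Hf|].
- intros x y [d [Hd H]]; exists (d / 2); split; [lra|]; intros x' y' Hx Hy.
  exists (d / 2); split; [lra|]; intros x'' y'' Hx' Hy'; apply H.
  + pose proof (Rabs_diff_triang x'' x' x); lra.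
  + pose proof (Rabs_diff_triang y'' y' y); lra.
- exists d; split; [assumption|]; intros x y x' y' Hxy Hx Hy.
  destruct (H x y x' y' Hxy Hx Hy) as [d' [Hd' H']].
  apply H'; rewrite Rminus_diag, Rabs_R0; assumption.
Qed.

Lemma smooth_solenoidal_approximation K (w : bool -> R -> R -> R) eps :
  compact2 K -> (forall b, Ck 1 (w b)) -> (forall b, compact_supp (w b)) ->
  (forall x y, div2 (w true) (w false) x y = 0) -> (forall b, supp_disjoint (w b) K) ->
  0 < eps ->
  exists W : bool -> R -> R -> R,
    (forall b, Cinf (W b) /\ compact_supp (W b) /\ supp_disjoint (W b) K) /\
    (forall x y, div2 (W true) (W false) x y = 0) /\
    (forall b x y, Rabs (W b x y - w b x y) <= eps) /\
    (forall b c x y, Rabs (pd c (W b) x y - pd c (w b) x y) <= eps).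
Proof.
intros HK Hw Hsupp Hdiv Hdisj Heps.
destruct (bool2_common_radius (fun b c d =>
  (forall x y x' y', K x y -> Rabs (x' - x) <= d -> Rabs (y' - y) <= d -> w b x' y' = 0) /\
  (forall x y x' y', Rabs (x' - x) < d -> Rabs (y' - y) < d ->
     Rabs (w b x' y' - w b x y) < eps / 2) /\
  (forall x y x' y', Rabs (x' - x) < d -> Rabs (y' - y) < d ->
     Rabs (pd c (w b) x' y' - pd c (w b) x y) < eps / 2))) as [d [Hd Hall]].
{ intros b c d d' Hdd' [P1 [P2 P3]]; repeat split; intros x y x' y'.
  - intros Hxy Hx Hy; apply (P1 x y); [assumption | lra | lra].
  - intros Hx Hy; apply P2; lra.
  - intros Hx Hy; apply P3; lra. }
{ intros b c.
  destruct (supp_disjoint_uniform K (w b) HK (Hdisj b)) as [d1 [Hd1 P1]].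
  destruct (compact_supp_unifcont (w b) (Ck_cont 1 _ (Hw b)) (Hsupp b) (eps / 2)) as [d2 [Hd2 P2]];
    [lra|].
  destruct (compact_supp_unifcont (pd c (w b)) (Ck_cont 0 _ (Ck_pd 0 _ c (Hw b)))
    (compact_supp_pd c _ (Hsupp b)) (eps / 2)) as [d3 [Hd3 P3]]; [lra|].
  pose proof (Rmin_l d1 (Rmin d2 d3)); pose proof (Rmin_r d1 (Rmin d2 d3)).
  pose proof (Rmin_l d2 d3); pose proof (Rmin_r d2 d3).
  exists (Rmin d1 (Rmin d2 d3)); split; [repeat apply Rmin_pos; assumption|].
  repeat split; intros x y x' y'.
  - intros Hxy Hx Hy; apply (P1 x y); [assumption | lra | lra].
  - intros Hx Hy; apply P2; lra.
  - intros Hx Hy; apply P3; lra. }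
(* At range [d / 2], the values within [d / 2] of [K] are averages over points within [d] of [K],
   where [w] vanishes. *)
destruct (mollifier_operator (d / 2)) as [T [Tsmooth [Tpd [Topp [Tzero Tclose]]]]]; [lra|].
exists (fun b => T (w b)); split; [|split; [|split]].
- intros b; split; [apply Tsmooth; [apply (Ck_cont 1), Hw | apply Hsupp]|]; split.
  + destruct (Hsupp b) as [M HM]; exists (M + d / 2); intros x y Hxy; apply Tzero.
    intros x' y' Hx Hy; apply HM; destruct Hxy as [H | H]; [left | right].
    * rewrite Rabs_minus_sym in Hx; pose proof (Rabs_triang_inv x x'); lra.
    * rewrite Rabs_minus_sym in Hy; pose proof (Rabs_triang_inv y y'); lra.
  + intros x y Hxy; exists (d / 2); split; [lra|]; intros x' y' Hx Hy; apply Tzero.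
    intros x'' y'' Hx' Hy'; apply (proj1 (Hall b true) x y); [assumption | |].
    * pose proof (Rabs_diff_triang x'' x' x); lra.
    * pose proof (Rabs_diff_triang y'' y' y); lra.
- intros x y; unfold div2.
  change (pd true (T (w true)) x y + pd false (T (w false)) x y = 0).
  rewrite !Tpd by apply Hw.
  (* Since [div w = 0], the two mollified derivatives are opposite by oddness of [T]. *)
  replace (pd false (w false)) with (fun x y => - pd true (w true) x y).
  + rewrite Topp by (apply (Ck_cont 0), Ck_pd, Hw); ring.
  + extensionality u; extensionality z; specialize (Hdiv u z); unfold div2 in Hdiv; simpl; lra.
- intros b x y; replace eps with (2 * (eps / 2)) by field.
  apply Tclose; [apply (Ck_cont 1), Hw|].
  intros u z u' z' Hu Hz; apply Rlt_le, (Hall b true); lra.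
- intros b c x y; rewrite Tpd by apply Hw; replace eps with (2 * (eps / 2)) by field.
  apply Tclose; [apply (Ck_cont 0), Ck_pd, Hw|].
  intros u z u' z' Hu Hz; apply Rlt_le, (Hall b c); lra.
Qed.

Lemma solenoidal_approximation K u1 u2 eps :
  compact2 K -> Ck 2 u1 -> Ck 2 u2 -> compact_supp u1 -> compact_supp u2 ->
  (forall x y, div2 u1 u2 x y = 0) ->
  (forall x y, K x y ->
     u1 x y = 0 /\ u2 x y = 0 /\
     dx u1 x y = 0 /\ dy u1 x y = 0 /\ dx u2 x y = 0 /\ dy u2 x y = 0) ->
  0 < eps ->
  exists W : bool -> R -> R -> R,
    (forall b, Cinf (W b) /\ compact_supp (W b) /\ supp_disjoint (W b) K) /\
    (forall x y, div2 (W true) (W false) x y = 0) /\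
    (forall x y, Rabs (W true x y - u1 x y) <= eps /\ Rabs (W false x y - u2 x y) <= eps) /\
    (forall c x y, Rabs (pd c (W true) x y - pd c u1 x y) <= eps /\
                   Rabs (pd c (W false) x y - pd c u2 x y) <= eps).
Proof.
intros HK Hu1 Hu2 Hs1 Hs2 Hdiv H0 Heps.
destruct (stream_function_exists u1 u2 (Ck_pred _ _ Hu1) (Ck_pred _ _ Hu2) Hs2 Hdiv) as [psi Hpsi].
pose (v := fun (b : bool) x y => if b then - u2 x y else u1 x y).
assert (Hpd2 : forall c, pd c (v true) = fun x y => - pd c u2 x y).
{ intros c; apply (pd_opp 1), Hu2. }
destruct (flattening_exists K psi v (eps / 2) HK) as [V [HV [HVs [HVd [HVdd HVK]]]]].
- intros []; [apply Ck_opp, Hu2 | exact Hu1].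
- intros []; [apply compact_supp_opp, Hs2 | exact Hs1].
- exact Hpsi.
- intros x y Hxy; destruct (H0 x y Hxy) as [E1 [E2 [E3 [E4 [E5 E6]]]]].
  intros []; split.
  + simpl; rewrite E2; ring.
  + intros c; rewrite Hpd2; destruct c; simpl; [rewrite E5 | rewrite E6]; ring.
  + exact E1.
  + intros []; [exact E3 | exact E4].
- lra.
- pose (w := fun (b : bool) x y => if b then u1 x y + - pd false V x y else u2 x y + pd true V x y).
  assert (HVx := Ck_pd 1 _ true HV); assert (HVy := Ck_pd 1 _ false HV).
  assert (Hu1' := Ck_pred _ _ Hu1); assert (Hu2' := Ck_pred _ _ Hu2).
  assert (Hw1 : forall c, pd c (w true) = fun x y => pd c u1 x y + - pd c (pd false V) x y).
  { intros c; unfold w; rewrite (pd_plus 0); [|assumption | apply Ck_opp, HVy].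
    rewrite (pd_opp 0) by assumption; reflexivity. }
  assert (Hw2 : forall c, pd c (w false) = fun x y => pd c u2 x y + pd c (pd true V) x y).
  { intros c; apply (pd_plus 0); assumption. }
  destruct (smooth_solenoidal_approximation K w (eps / 2) HK) as [W [HW [HWdiv [HWc HWd]]]].
  + intros []; apply Ck_plus; try assumption; apply Ck_opp, HVy.
  + intros []; apply compact_supp_plus; try assumption; [apply compact_supp_opp|];
      apply compact_supp_pd, HVs.
  + intros x y; unfold div2; change (pd true (w true) x y + pd false (w false) x y = 0).
    rewrite Hw1, Hw2; specialize (Hdiv x y); unfold div2 in Hdiv.
    assert (Hsch := Ck2_schwarz V x y HV); simpl; lra.
  + intros b x y Hxy; destruct (HVK x y Hxy) as [d [k [Hd HVeq]]].
    exists d; split; [assumption|]; intros x' y' Hx Hy.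
    destruct (open2_box x y d x' y' (conj Hx Hy)) as [d' [Hd' Hbox]].
    assert (Hpdeq : forall c, pd c V x' y' = v c x' y').
    { intros c; rewrite (pd_ext_loc c V (fun x y => psi x y + k) x' y' d' Hd').
      - apply is_pd_unique; rewrite <- (Rplus_0_r (v c x' y')).
        apply is_pd_plus; [apply Hpsi | apply is_pd_const].
      - intros u z Hu Hz; destruct (Hbox u z Hu Hz); apply HVeq; assumption. }
    unfold w; destruct b; rewrite Hpdeq; simpl; ring.
  + lra.
  + exists W; split; [exact HW|]; split; [exact HWdiv|]; split.
    * intros x y; split.
      -- assert (T1 := HWc true x y); assert (T2 := HVd false x y); unfold w in T1.
         apply Rabs_le_between in T1; apply Rabs_le_between in T2; apply Rabs_le_between; lra.
      -- assert (T1 := HWc false x y); assert (T2 := HVd true x y); unfold w in T1.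
         apply Rabs_le_between in T1; apply Rabs_le_between in T2; apply Rabs_le_between; lra.
    * intros c x y; split.
      -- assert (T1 := HWd true c x y); assert (T2 := HVdd c false x y); rewrite Hw1 in T1.
         apply Rabs_le_between in T1; apply Rabs_le_between in T2; apply Rabs_le_between; lra.
      -- assert (T1 := HWd false c x y); assert (T2 := HVdd c true x y); rewrite Hw2 in T1.
         apply Rabs_le_between in T1; apply Rabs_le_between in T2; apply Rabs_le_between; lra.
Qed.

Theorem theorem1p4 (K : R -> R -> Prop) (u1 u2 : R -> R -> R) :
  compact2 K ->
  Ck 2 u1 -> Ck 2 u2 -> compact_supp u1 -> compact_supp u2 ->
  (forall x y, div2 u1 u2 x y = 0) ->
  (forall x y, K x y ->
     u1 x y = 0 /\ u2 x y = 0 /\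
     dx u1 x y = 0 /\ dy u1 x y = 0 /\ dx u2 x y = 0 /\ dy u2 x y = 0) ->
  exists (uk1 uk2 : nat -> R -> R -> R),
    (forall k, Cinf (uk1 k) /\ Cinf (uk2 k) /\
               compact_supp (uk1 k) /\ compact_supp (uk2 k) /\
               (forall x y, div2 (uk1 k) (uk2 k) x y = 0) /\
               supp_disjoint (uk1 k) K /\ supp_disjoint (uk2 k) K) /\
    C1_conv uk1 u1 /\ C1_conv uk2 u2.
Proof.
intros HK Hu1 Hu2 Hs1 Hs2 Hdiv H0.
assert (Hpos : forall n, 0 < / (INR n + 1)).
{ intros n; apply Rinv_0_lt_compat; pose proof (pos_INR n); lra. }
pose (pick := fun n => constructive_indefinite_description _
  (solenoidal_approximation K u1 u2 _ HK Hu1 Hu2 Hs1 Hs2 Hdiv H0 (Hpos n))).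
assert (Hlim : forall eps, 0 < eps -> exists N, forall n, (N <= n)%nat -> / (INR n + 1) <= eps).
{ intros eps Heps; destruct (nfloor_ex (/ eps)) as [N HN].
  { apply Rlt_le, Rinv_0_lt_compat, Heps. }
  exists N; intros n Hn; apply le_INR in Hn.
  rewrite <- (Rinv_inv eps); apply Rinv_le_contravar; [apply Rinv_0_lt_compat, Heps | lra]. }
exists (fun n => proj1_sig (pick n) true), (fun n => proj1_sig (pick n) false).
split; [|split].
- intros n; destruct (proj2_sig (pick n)) as [HW [HWdiv _]].
  destruct (HW true) as [A1 [A2 A3]]; destruct (HW false) as [B1 [B2 B3]]; tauto.
- intros eps Heps; destruct (Hlim eps Heps) as [N HN]; exists N; intros n Hn x y.
  specialize (HN n Hn); destruct (proj2_sig (pick n)) as [_ [_ [Hc Hd]]].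
  destruct (Hc x y) as [T1 _]; destruct (Hd true x y) as [T2 _]; destruct (Hd false x y) as [T3 _].
  simpl in T2, T3; repeat split; lra.
- intros eps Heps; destruct (Hlim eps Heps) as [N HN]; exists N; intros n Hn x y.
  specialize (HN n Hn); destruct (proj2_sig (pick n)) as [_ [_ [Hc Hd]]].
  destruct (Hc x y) as [_ T1]; destruct (Hd true x y) as [_ T2]; destruct (Hd false x y) as [_ T3].
  simpl in T2, T3; repeat split; lra.
Qed.
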